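(* Let $V:E\to\mathbb{R}$ be a measurable solution to $$V(x)=\mathcal{W}(f(x),g(x),h(x),\alpha\Pi V(x)),\quad\text{for all }x\in E,$$ and, with the sets $B_1,\dots,B_8$ (depending on $V$) given in the context, choose measurable functions $p^{(1)},p^{(2)}:E\to[0,1]$ such that \begin{itemize} \item[(i)] $x\in B_1\Rightarrow p^{(1)}(x)=p^{(2)}(x)=1$, \item[(ii)] $x\in B_2\Rightarrow p^{(1)}(x)=1,\ p^{(2)}(x)=0$, \item[(iii)] $x\in B_3\Rightarrow p^{(1)}(x)=p^{(2)}(x)=0$, \item[(iv)] $x\in B_4\Rightarrow p^{(1)}(x)=0,\ p^{(2)}(x)=1$, \item[(v)] $x\in B_5\Rightarrow p^{(1)}(x)=p^{(2)}(x)=0$, \item[(vi)] $x\in B_6\Rightarrow p^{(1)}(x)=0,\ p^{(2)}(x)=1$, \item[(vii)] $x\in B_7\Rightarrow p^{(1)}(x)=1,\ p^{(2)}(x)=0$, \item[(viii)] $x\in B_8\Rightarrow p^{(1)}(x)=\dfrac{g(x)-\alpha\Pi V(x)}{f(x)-h(x)-\alpha\Pi V(x)+g(x)},\quad p^{(2)}(x)=\dfrac{f(x)-\alpha\Pi V(x)}{f(x)-h(x)-\alpha\Pi V(x)+g(x)}$. \end{itemize} Then $(p^{(1)},p^{(2)})$ is a global Markovian equilibrium of the zero-sum game with value $V$. In particular, every zero-sum game (satisfying the standing assumptions in the context) has a global Markovian equilibrium.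
   Context: Setting. $X=(X_n)_{n\in\mathbb{N}_0}$ is a homogeneous Markov process with (measurable) state space $E$ and Markov kernel $\Pi$; under $\mathbb{P}_x$ (expectation $\mathbb{E}_x$) it starts at $X_0=x\in E$. Write $\Pi u(x)=\int_E u(y)\,\Pi(x,dy)$. The discount factor $\alpha\in(0,1)$ is constant and $f,g,h:E\to\mathbb{R}$ are measurable. The probability space supports two sequences $(\xi^{(i)}_n)_{n\in\mathbb{N}_0}$, $i=1,2$, of iid uniform $(0,1)$ random variables, independent of $X$ and of each other. Killed process. $\tilde X$ is the process $X$ killed at each time step with probability $1-\alpha$ (independently of everything else): $\tilde X_n=X_n$ for $n\le T$ and $\tilde X_n=K$ for $n>T$, where $\mathbb{P}(T=k)=(1-\alpha)\alpha^k$, $k\in\mathbb{N}_0$, and $K$ is an absorbing cemetery state at which all functions take the value $0$. Standing integrability assumption. Under every $\mathbb{P}_x$: $\sup_{n}|f(\tilde X_n)|,\ \sup_{n}|g(\tilde X_n)|,\ \sup_{n}|h(\tilde X_n)|\in L^1$. Stopping times. $\mathcal{T}_i$ is the set of ($\mathbb{N}_0\cup\{\infty\}$-valued) stopping times with respect to the filtration $\sigma(X_0,\dots,X_n,\xi^{(i)}_0,\dots,\xi^{(i)}_n)$, $n\in\mathbb{N}_0$. For measurable $p^{(i)}:E\to[0,1]$, let $\tau^{p^{(i)}}=\inf\{n\in\mathbb{N}_0:\ p^{(i)}(X_n)\ge\xi^{(i)}_n\}$ ($\inf\emptyset=\infty$), the Markovian randomized stopping time of player $i$ identified with $p^{(i)}$.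 Zero-sum game. Player 1 chooses $\tau_1\in\mathcal{T}_1$ to maximize, and player 2 chooses $\tau_2\in\mathcal{T}_2$ to minimize, $$J_1(x;\tau_1,\tau_2)=\mathbb{E}_x\big[\alpha^{\tau_1}f(X_{\tau_1})\mathbb{I}_{\{\tau_1<\tau_2\}}+\alpha^{\tau_2}g(X_{\tau_2})\mathbb{I}_{\{\tau_2<\tau_1\}}+\alpha^{\tau_1}h(X_{\tau_1})\mathbb{I}_{\{\tau_1=\tau_2<\infty\}}\big].$$ $(p^{(1)},p^{(2)})$ is a global Markovian (randomized) equilibrium if for all $x\in E$: $\sup_{\tau_1\in\mathcal{T}_1}J_1(x;\tau_1,\tau^{p^{(2)}})=J_1(x;\tau^{p^{(1)}},\tau^{p^{(2)}})=\inf_{\tau_2\in\mathcal{T}_2}J_1(x;\tau^{p^{(1)}},\tau_2)$. Its value is $x\mapsto J_1(x;\tau^{p^{(1)}},\tau^{p^{(2)}})$. The function $\mathcal{W}$. Write $\mathrm{med}(a,b,c)=\min\{\max\{a,b\},\max\{a,c\},\max\{b,c\}\}$ for the middle value. $\mathcal{W}:\mathbb{R}^4\to\mathbb{R}$ is defined (for real numbers $f,g,h,w$; the cases agree where they overlap) by $$\mathcal{W}(f,g,h,w)=\begin{cases} h & \text{if } g\le h\le f\\ \mathrm{med}(f,g,w) & \text{if } f\le h\le g\\ w & \text{if } (h<f\wedge g\text{ or }h>f\vee g)\text{ and } f\le w\le g\\ g & \text{if } h<f\wedge g\text{ and } w\ge g\\ f & \text{if } h>f\vee g\text{ and } w\le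 f\\ \frac{gf-wh}{g-h+f-w} & \text{if } h\wedge w>f\vee g\text{ or } h\vee w<f\wedge g.\end{cases}$$ The sets $B_i$. For the given solution $V$: $B_1=\{x: g(x)\le h(x)\le f(x)\}$; $B_2=\{x: f(x)\le h(x)\le g(x),\ \alpha\Pi V(x)<f(x)\}\setminus B_1$; $B_3=\{x: f(x)\le h(x)\le g(x),\ f(x)\le\alpha\Pi V(x)\le g(x)\}\setminus\bigcup_{i=1}^2B_i$; $B_4=\{x: f(x)\le h(x)\le g(x),\ g(x)<\alpha\Pi V(x)\}\setminus\bigcup_{i=1}^3B_i$; $B_5=\{x:(h(x)<f(x)\wedge g(x)\text{ or }h(x)>f(x)\vee g(x))\text{ and }f(x)\le\alpha\Pi V(x)\le g(x)\}\setminus\bigcup_{i=1}^4B_i$; $B_6=\{x: h(x)<f(x)\wedge g(x)\text{ and }\alpha\Pi V(x)\ge g(x)\}\setminus\bigcup_{i=1}^5B_i$; $B_7=\{x: h(x)>f(x)\vee g(x)\text{ and }\alpha\Pi V(x)\le f(x)\}\setminus\bigcup_{i=1}^6B_i$; $B_8=\{x: h(x)\wedge\alpha\Pi V(x)>f(x)\vee g(x)\text{ or }h(x)\vee\alpha\Pi V(x)<f(x)\wedge g(x)\}\setminus\bigcup_{i=1}^7B_i$ (all $x\in E$). *)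

(* Defs.v *)
From HB Require Import structures.
From mathcomp Require Import all_boot all_order all_algebra.
From mathcomp Require Import finmap lra.
From mathcomp Require Import all_classical all_reals all_analysis.
Set Implicit Arguments.
Unset Strict Implicit.
Unset Printing Implicit Defensive.
Import Order.TTheory GRing.Theory Num.Theory.
Local Open Scope classical_set_scope.
Local Open Scope ring_scope.

Section value_function.
Context {R : realType}.
Implicit Types f g h w : R.

Definition med (a b c : R) : R :=
  Num.min (Num.max a b) (Num.min (Num.max a c) (Num.max b c)).

(* The cases are exhaustive (W_exhaustive), so the last [else] is never
   reached, and they agree where they overlap (W_cases), so the order in which
   they are tested is immaterial. *)
Definition W f g h w : R :=
  if g <= h <= f then h
  else if f <= h <= g then med f g w
  else if ((h < Num.min f g) || (h > Num.max f g)) && (f <= w <= g) then w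
  else if (h < Num.min f g) && (w >= g) then g
  else if (h > Num.max f g) && (w <= f) then f
  else if (Num.min h w > Num.max f g) || (Num.max h w < Num.min f g) then
    (g * f - w * h) / (g - h + f - w)
  else 0.

Lemma W_exhaustive f g h w :
  [\/ g <= h <= f, f <= h <= g,
      ((h < Num.min f g) || (h > Num.max f g)) && (f <= w <= g)
    | [\/ (h < Num.min f g) && (w >= g), (h > Num.max f g) && (w <= f)
        | (Num.min h w > Num.max f g) || (Num.max h w < Num.min f g)]].
Proof.
rewrite !lt_min !gt_max.
case: (lerP g h) => gh; case: (lerP h f) => hf; case: (lerP f h) => fh;
  case: (lerP h g) => hg; case: (lerP f w) => fw; case: (lerP w g) => wg;
  case: (lerP g w) => gw; case: (lerP w f) => wf;
  rewrite /= ?fh ?hf ?gh ?hg ?fw ?gw ?wf ?wg ?(ltW fh) /=;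
  try (by [constructor 1]); try (by [constructor 2]);
  try (by [constructor 3]); try (by [constructor 4; constructor 1]);
  try (by [constructor 4; constructor 2]);
  try (by [constructor 4; constructor 3]); lra.
Qed.

Lemma W_cases f g h w :
  [/\ g <= h <= f -> W f g h w = h,
      f <= h <= g -> W f g h w = med f g w,
      (h < Num.min f g \/ h > Num.max f g) /\ f <= w <= g -> W f g h w = w
    & [/\ h < Num.min f g /\ w >= g -> W f g h w = g,
          h > Num.max f g /\ w <= f -> W f g h w = f
        & Num.min h w > Num.max f g \/ Num.max h w < Num.min f g ->
          W f g h w = (g * f - w * h) / (g - h + f - w)]].
Proof.
have medxx a : med a a w = a.
  by rewrite /med maxxx minxx maxElt; case: ifPn; rewrite minElt; case: ifPn;
    move=> *; lra.
have medE : f = g -> med f g w = g by move=> ->.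
rewrite /W; move: (med f g w) medE => m medE.
rewrite !lt_min !gt_max.
split=> [||[]|]; last split=> [[]|[]|];
  repeat match goal with |- context [if ?b then _ else _] =>
    case: (boolP b) => ? //= end;
  try (by move=> *; lra); try (by case=> *; lra);
  by move=> *; rewrite ?medE; lra.
Qed.

End value_function.

Section regions.
Context {R : realType} {E : Type}.
Variables f g h w : E -> R.

(* [w] stands for alpha * Pi V. *)
Definition B1 : set E := [set x | g x <= h x <= f x].

Definition B2 : set E :=
  [set x | f x <= h x <= g x /\ w x < f x] `\` B1.

Definition B3 : set E :=
  [set x | f x <= h x <= g x /\ f x <= w x <= g x] `\` (B1 `|` B2).

Definition B4 : set E :=
  [set x | f x <= h x <= g x /\ g x < w x] `\` (B1 `|` B2 `|` B3).

Definition B5 : set E :=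
  [set x | (h x < Num.min (f x) (g x) \/ h x > Num.max (f x) (g x)) /\
           f x <= w x <= g x] `\` (B1 `|` B2 `|` B3 `|` B4).

Definition B6 : set E :=
  [set x | h x < Num.min (f x) (g x) /\ w x >= g x]
  `\` (B1 `|` B2 `|` B3 `|` B4 `|` B5).

Definition B7 : set E :=
  [set x | h x > Num.max (f x) (g x) /\ w x <= f x]
  `\` (B1 `|` B2 `|` B3 `|` B4 `|` B5 `|` B6).

Definition B8 : set E :=
  [set x | Num.min (h x) (w x) > Num.max (f x) (g x) \/
           Num.max (h x) (w x) < Num.min (f x) (g x)]
  `\` (B1 `|` B2 `|` B3 `|` B4 `|` B5 `|` B6 `|` B7).

Definition saddle_choice (p1 p2 : E -> R) : Prop :=
  forall x,
  [/\ B1 x -> p1 x = 1 /\ p2 x = 1,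
      B2 x -> p1 x = 1 /\ p2 x = 0,
      B3 x -> p1 x = 0 /\ p2 x = 0
    & B4 x -> p1 x = 0 /\ p2 x = 1] /\
  [/\ B5 x -> p1 x = 0 /\ p2 x = 0,
      B6 x -> p1 x = 0 /\ p2 x = 1,
      B7 x -> p1 x = 1 /\ p2 x = 0
    & B8 x -> p1 x = (g x - w x) / (f x - h x - w x + g x) /\
              p2 x = (f x - w x) / (f x - h x - w x + g x)].

End regions.

Section independence.
Context {d : measure_display} {Omega : measurableType d} {R : realType}.
Variable P : probability Omega R.

(* Mutual independence of a family of sigma-algebras. *)
Definition mutually_independent (I : choiceType) (G : I -> set_system Omega) :=
  forall (J : {fset I}) (A : I -> set Omega),
    (forall i, i \in J -> G i (A i)) ->
    P (\bigcap_(i in [set` J]) A i) = (\prod_(i <- J) P (A i))%E.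

End independence.

Section generated.
Context {dO dF : measure_display} {Omega : measurableType dO}
        {F : measurableType dF}.

(* sigma(Y_k : k in D) *)
Definition sigma_of (D : set nat) (Y : nat -> Omega -> F) : set_system Omega :=
  <<s \bigcup_(k in D) preimage_set_system setT (Y k) measurable >>.

End generated.

Section setting.
Context {R : realType} {dE dO : measure_display}
        {E : measurableType dE} {Omega : measurableType dO}.
Implicit Types (Q : probability Omega R) (X : nat -> {mfun Omega >-> E})
  (xi : nat -> {mfun Omega >-> R}) (T : {mfun Omega >-> nat}).

(* Under [Q], [X] is a homogeneous Markov process with kernel [Pi] started at
   [x]. Singletons of [E] need not be measurable, so X_0 = x is the statement
   that X_0 has law dirac at [x]. The second clause says that Pi(X_n, A) is a
   version of Q(X_{n+1} \in A | X_0, ..., X_n). *)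
Definition markov_process (Pi : R.-pker E ~> E) X (x : E) Q : Prop :=
  (forall A, measurable A -> Q (X 0%N @^-1` A) = \d_x A) /\
  (forall n D A, sigma_of [set k | (k <= n)%N] (fun k => X k) D ->
     measurable A ->
     Q (D `&` X n.+1 @^-1` A) = (\int[Q]_(om in D) Pi (X n om) A)%E).

Definition iid_uniform01 xi Q : Prop :=
  (forall n A, measurable A -> Q (xi n @^-1` A) = uniform_prob (@ltr01 R) A) /\
  mutually_independent Q
    (fun n => preimage_set_system setT (xi n) measurable).

(* T is the last time at which the killed process is alive. *)
Definition killing_time (alpha : R) T Q : Prop :=
  forall k, Q (T @^-1` [set k]) = ((1 - alpha) * alpha ^+ k)%:E.

Definition independent_sources X xi1 xi2 T Q : Prop :=
  mutually_independent Q (fun i : 'I_4 =>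
    nth set0 [:: sigma_of setT (fun n => X n); sigma_of setT (fun n => xi1 n);
                 sigma_of setT (fun n => xi2 n);
                 preimage_set_system setT T measurable] i).

(* [None] is the cemetery state. *)
Definition killed X T (n : nat) (om : Omega) : option E :=
  if (n <= T om)%N then Some (X n om) else None.

Definition killed_sup_integrable X T (u : E -> R) Q : Prop :=
  Q.-integrable setT (fun om =>
    ereal_sup (range (fun n => `|oapp u 0 (killed X T n om)|%:E))).

(* Random times take values in nat with infinity, encoded as [option nat],
   [None] being infinity. *)
Definition filtration X xi (n : nat) : set_system Omega :=
  <<s \bigcup_(k in [set k | (k <= n)%N])
        (preimage_set_system setT (X k) measurable `|`
         preimage_set_system setT (xi k) measurable) >>.

Definition stopping_time X xi (tau : Omega -> option nat) : Prop :=
  forall n, filtration X xi n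
    [set om | exists2 k, tau om = Some k & (k <= n)%N].

Definition randomization (p : E -> R) : Prop :=
  measurable_fun setT p /\ forall x, 0 <= p x <= 1.

(* inf {n | p (X_n) >= xi_n} *)
Definition markov_time X xi (p : E -> R) (om : Omega) : option nat :=
  match pselect (exists n, p (X n om) >= xi n om) with
  | left ex => Some (ex_minn ex)
  | right _ => None
  end.

Definition payoff (alpha : R) (f g h : E -> R) X (tau1 tau2 : Omega -> option nat)
    (om : Omega) : R :=
  match tau1 om, tau2 om with
  | Some m, Some n =>
      if (m < n)%N then alpha ^+ m * f (X m om)
      else if (n < m)%N then alpha ^+ n * g (X n om)
      else alpha ^+ m * h (X m om)
  | Some m, None => alpha ^+ m * f (X m om)
  | None, Some n => alpha ^+ n * g (X n om)
  | None, None => 0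
  end.

Definition J1 (alpha : R) (f g h : E -> R) X Q
    (tau1 tau2 : Omega -> option nat) : \bar R :=
  ('E_Q[payoff alpha f g h X tau1 tau2])%E.

Definition global_markov_equilibrium (alpha : R) (f g h : E -> R) X xi1 xi2
    (P : E -> probability Omega R) (p1 p2 : E -> R) : Prop :=
  let J x := J1 alpha f g h X (P x) in
  let t1 := markov_time X xi1 p1 in
  let t2 := markov_time X xi2 p2 in
  forall x,
    ereal_sup [set J x tau1 t2 | tau1 in stopping_time X xi1] = J x t1 t2 /\
    J x t1 t2 = ereal_inf [set J x t1 tau2 | tau2 in stopping_time X xi2].

(* alpha Pi V. The real-valued integral is 0 when V is not integrable; this
   does not occur for solutions V of V = W(f, g, h, alpha Pi V), which satisfy
   |V| <= |f| + |g| + |h|. *)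
Definition discounted (alpha : R) (Pi : R.-pker E ~> E) (V : E -> R) (x : E) : R :=
  alpha * \int[Pi x]_y V y.

End setting.

(* Main.v *)
Require Import Defs.
From HB Require Import structures.
From mathcomp Require Import all_boot all_order all_algebra.
From mathcomp Require Import finmap ring lra.
From mathcomp Require Import all_classical all_reals all_analysis.
From mathcomp Require Import measurable_realfun giry.
Set Implicit Arguments.
Unset Strict Implicit.
Unset Printing Implicit Defensive.
Import Order.TTheory GRing.Theory Num.Theory.
Import numFieldNormedType.Exports.
Local Open Scope classical_set_scope.
Local Open Scope ring_scope.

(**
At a state y where nobody has stopped yet, the two players face a two-by-two
zero-sum game: each stops or goes on, and the payoff matrix has the entries
h(y) (both stop), f(y) (only player 1 stops), g(y) (only player 2 stops) and
w = alpha Pi V(y) (both go on). The function W is the value of this matrix game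
and the probabilities p1(y), p2(y) prescribed on B_1, ..., B_8 form a saddle
point of it ([matrix_saddle_W], [saddle_choice_optimal_stop]). Hence, if V
solves V = W(f, g, h, alpha Pi V), each player can secure V(y) at y in one
round, and the dynamic programming principle propagates this to the whole game.

In detail, let player 2 use p2 and player 1 an arbitrary stopping time tau1. Pay
alpha^n V(X_n) to player 1 if the game is still alive at time n, and the actual
payoff otherwise ([stopped_payoff]). The expectation of this truncated payoff
does not increase with n: the draw of player 2 at time n is independent of all
that player 1 knows, so it may be averaged out ([ge0_integral_draw]), the next
state may be replaced by its conditional law ([ge0_integral_transition]), and
then the saddle inequalities of player 2 apply. At n = 0 the expectation is
V(x), and for n to infinity it tends to the payoff of the game
([expected_payoff_le]). The bound for player 1 is the same statement for the
game with exchanged roles and opposite signs ([payoff_swap],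
[matrix_saddle_opp]).

Everything is dominated by phi = |f| + |g| + |h|, which also bounds V. The
killing time T is geometric and independent of X, so that
(1 - alpha) sum_n alpha^n E|f(X_n)| = E|f(X_T)| <= E sup_n |f(killed X_n)|:
the integrability of the suprema makes the discounted moments summable
([killed_sup_finite_moment]), and their sum is the integral of a dominating
function for the passage to the limit.

For the existence of an equilibrium, W is nondecreasing and 1-Lipschitz in w and
bounded by phi, so the value iteration started at -phi increases to a measurable
solution V ([exists_measurable_fixpoint]).
*)

(** * Integration against laws and conditional laws *)

Section measure_tools.
Context d (T : measurableType d) (R : realType).
Local Open Scope ereal_scope.

Lemma ge0_integral_mrestr (mu : {measure set T -> \bar R}) (A : set T)
    (mA : measurable A) (F : T -> \bar R) :
  measurable_fun setT F -> (forall x, 0 <= F x) ->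
  \int[mrestr mu mA]_x F x = \int[mu]_(x in A) F x.
Proof.
move=> mF F0.
rewrite (@ge0_negligible_integral _ _ _ (mrestr mu mA) setT (~` A))//=.
- rewrite setDE setTI setCK; apply: eq_measure_integral => B mB BA.
  by change (mu (B `&` A) = mu B); rewrite setIidl.
- exact: measurableC.
- by rewrite /mrestr setICl measure0.
Qed.

(** The uniqueness theorem for finite measures on a pi-system that contains the
    whole space, which spares the covering sequence of the general theorem. *)
Lemma eq_measure_generated (G : set_system T)
    (m1 m2 : {measure set T -> \bar R}) :
  G `<=` measurable -> setI_closed G -> G setT -> m1 setT < +oo ->
  (forall A, G A -> m1 A = m2 A) -> forall A, <<s G >> A -> m1 A = m2 A.
Proof.
move=> Gm GI GT fin12 m12 A.
apply: (g_sigma_algebra_measure_unique G Gm (fun=> setT)) => //.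
by rewrite -subTset => x _; exists 0%N.
Qed.

Section restriction.
Variables (Q : probability T R) (A : set T) (mA : measurable A).

Definition restricted_probability : set T -> \bar R := mrestr Q mA.

HB.instance Definition _ := Measure.on restricted_probability.

Let restricted_setT : restricted_probability setT <= 1.
Proof. by rewrite /restricted_probability /mrestr setTI probability_le1. Qed.

HB.instance Definition _ :=
  Measure_isSubProbability.Build _ _ _ restricted_probability
  restricted_setT.

End restriction.

(** The two sides integrate [F] against the same measure, once as an image
    measure and once as a bind of the Giry monad; the third hypothesis says
    that [K] is a conditional law of [Y] on [A]. *)
Lemma disintegration (Q : probability T R) dS (S : measurableType dS)
    (A : set T) (mA : measurable A) (Y : T -> S) (K : T -> giry S R)
      (F : S -> \bar R) :
  measurable_fun setT Y ->
  (forall C, measurable C -> measurable_fun setT (fun w => K w C)) ->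
  (forall C, measurable C -> Q (A `&` Y @^-1` C) = \int[Q]_(w in A) K w C) ->
  measurable_fun setT F -> (forall s, 0 <= F s) ->
  \int[Q]_(w in A) F (Y w) = \int[Q]_(w in A) \int[K w]_s F s.
Proof.
move=> mY mK QK mF F0.
have mK' : measurable_fun setT K by exact: measurable_giry_codensity.
pose QA : giry T R := restricted_probability Q mA.
have mFi : measurable_fun setT (fun w => \int[K w]_s F s).
  exact: (measurableT_comp (measurable_giry_int mF F0) mK').
rewrite -!(ge0_integral_mrestr Q mA)//; last 2 first.
- by move=> w; exact: integral_ge0.
- exact: measurableT_comp.
transitivity (giry_int (giry_map mY QA) F); first by rewrite giry_int_map.
transitivity (giry_int (giry_bind QA mK') F); last by rewrite giry_int_bind.
apply: eq_measure_integral => C mC _.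
transitivity (Q (A `&` Y @^-1` C)); first by rewrite setIC.
rewrite QK//.
rewrite -(ge0_integral_mrestr Q mA)//; last exact: mK.
transitivity (\int[giry_bind QA mK']_s (\1_C s)%:E); last first.
  by rewrite integral_indic// setIT.
have := @giry_int_bind _ _ _ _ R QA K mK' (EFin \o \1_C).
rewrite /giry_int => ->//.
- by apply: eq_integral => w _ /=; rewrite integral_indic// setIT.
- exact/measurable_EFinP.
- by move=> s; rewrite lee_fin.
Qed.

(** On [A], the pair [(Y, U)] has a product law, so that Fubini's theorem
    integrates the independent variable [U] first. *)
Lemma ge0_integral_indep (Q : probability T R) d1 d2 (S1 : measurableType d1)
    (S2 : measurableType d2) (nu : probability S2 R) (A : set T)
    (mA : measurable A) (Y : T -> S1) (U : T -> S2) (F : S1 * S2 -> \bar R) :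
  measurable_fun setT Y -> measurable_fun setT U ->
  (forall B C, measurable B -> measurable C ->
    Q (A `&` Y @^-1` B `&` U @^-1` C) = Q (A `&` Y @^-1` B) * nu C) ->
  measurable_fun setT F -> (forall s, 0 <= F s) ->
  \int[Q]_(w in A) F (Y w, U w) = \int[Q]_(w in A) \int[nu]_u F (Y w, u).
Proof.
move=> mY mU QYU mF F0.
have mYU : measurable_fun setT (fun w => (Y w, U w)).
  exact: measurable_fun_pair.
pose QA : giry T R := restricted_probability Q mA.
have mFi : measurable_fun setT (fun y => \int[nu]_u F (y, u)).
  exact: measurable_fun_fubini_tonelli_F.
rewrite -!(ge0_integral_mrestr Q mA)//; last 3 first.
- exact: measurableT_comp mFi mY.
- by move=> w; exact: integral_ge0.
- exact: measurableT_comp mF mYU.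
transitivity (giry_int (giry_map mYU QA) F); first by rewrite giry_int_map.
transitivity (giry_int (giry_map mY QA) (fun y => \int[nu]_u F (y, u))).
  rewrite /giry_int -fubini_tonelli1//.
  apply: eq_measure_integral => C mC _; apply/esym.
  apply: product_measure_unique => // B D mB mD.
  have QE : Q ((Y @^-1` B `&` U @^-1` D) `&` A) = Q (Y @^-1` B `&` A) * nu D.
    by rewrite setIC setIA (setIC _ A); exact: QYU.
  exact: QE.
by rewrite giry_int_map// => y; exact: integral_ge0.
Qed.

Lemma mutually_independent_seq (Q : probability T R) (I : choiceType)
    (G : I -> set_system T) (s : seq I) (A : I -> set T) :
  mutually_independent Q G -> uniq s -> (forall i, i \in s -> G i (A i)) ->
  Q (\bigcap_(i in [set` s]) A i) = \prod_(i <- s) Q (A i).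
Proof.
move=> indepG us GA.
have := indepG (seq_fset tt s) A; rewrite (perm_big s); last first.
  by have := seq_fset_perm tt s; rewrite undup_id.
rewrite (_ : [set` seq_fset tt s] = [set` s]).
  by apply=> i; rewrite seq_fsetE; exact: GA.
by apply/funext => i; congr is_true; exact: seq_fsetE.
Qed.

(** Both sides are finite measures in [A], so their equality extends from a
    pi-system to the sigma-algebra that it generates. *)
Lemma indep_generated (Q : probability T R) (G : set_system T) (C : set T) :
  G `<=` measurable -> setI_closed G -> G setT -> measurable C ->
  (forall A, G A -> Q (A `&` C) = Q A * Q C) ->
  forall A, <<s G >> A -> Q (A `&` C) = Q A * Q C.
Proof.
move=> Gm GI GT mC QG A GA.
have QC0 : (0 <= fine (Q C))%R by rewrite fine_ge0.
have scaleE B : mscale (NngNum QC0) Q B = Q B * Q C.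
  by rewrite /mscale/= fineK ?fin_num_measure// muleC.
rewrite -[RHS]scaleE.
apply: (@eq_measure_generated G (mrestr Q mC) (mscale (NngNum QC0) Q)) => //.
  by rewrite /= /mrestr setTI -ge0_fin_numE ?fin_num_measure.
by move=> B GB; transitivity (Q (B `&` C)) => //; rewrite QG// -scaleE.
Qed.

End measure_tools.

(** * Two-by-two matrix games *)

Section matrix_game.
Context {R : realType}.
Implicit Types f g h w v p q : R.

(** [v] is the value and [(p, q)] a pair of optimal mixed strategies of the
    matrix game where the row player maximizes, with rows (h, f) and (g, w);
    the first row and the first column stand for stopping, and [p] and [q] are
    the probabilities to stop. *)
Definition matrix_saddle f g h w v p q : Prop :=
  [/\ 0 <= p <= 1, 0 <= q <= 1,
      v <= p * h + (1 - p) * g /\ v <= p * f + (1 - p) * w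
    & q * h + (1 - q) * f <= v /\ q * g + (1 - q) * w <= v].

Lemma matrix_saddle_opp f g h w v p q : matrix_saddle f g h w v p q ->
  matrix_saddle (- g) (- f) (- h) (- w) (- v) q p.
Proof. by case=> p01 q01 [? ?] [? ?]; split=> //; split; lra. Qed.

(** Playing [p], optimal for [w], against [q'], optimal for [w'], secures [v]
    in the first game and concedes at most [v'] in the second one; the two
    games differ only when both players go on, which has probability [(1 - p) *
    (1 - q')]. *)
Lemma matrix_saddle_mixed f g h w w' v v' p p' q q' :
  matrix_saddle f g h w v p q -> matrix_saddle f g h w' v' p' q' ->
  v <= v' + (1 - p) * (1 - q') * (w - w').
Proof.
move=> [/andP[p0 p1] _ [vhg vfw] _] [_ /andP[q0 q1] _ [hfv gwv]].
have p1' : 0 <= 1 - p by lra.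
have q1' : 0 <= 1 - q' by lra.
have e1 := ler_wpM2l q0 vhg; have e2 := ler_wpM2l q1' vfw.
have e3 := ler_wpM2l p0 hfv; have e4 := ler_wpM2l p1' gwv.
lra.
Qed.

Lemma matrix_saddle_le f g h w w' v v' p p' q q' :
  matrix_saddle f g h w v p q -> matrix_saddle f g h w' v' p' q' ->
  w <= w' -> v <= v'.
Proof.
move=> S S' ww'; have := matrix_saddle_mixed S S'.
case: S => /andP[p0 p1] _ _ _; case: S' => _ /andP[q0 q1] _ _.
have : 0 <= (1 - p) * (1 - q') * (w' - w) by rewrite !mulr_ge0 ?subr_ge0.
lra.
Qed.

Lemma matrix_saddle_lipschitz f g h w w' v v' p p' q q' :
  matrix_saddle f g h w v p q -> matrix_saddle f g h w' v' p' q' ->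
  `|v - v'| <= `|w - w'|.
Proof.
wlog ww' : w w' v v' p p' q q' / w <= w' => [th S S'|S S'].
  have [ww'|/ltW w'w] := leP w w'; first exact: (th _ _ _ _ _ _ _ _ ww' S S').
  by rewrite distrC (distrC w); exact: (th _ _ _ _ _ _ _ _ w'w S' S).
have vv' := matrix_saddle_le S S' ww'.
rewrite distrC ger0_norm ?subr_ge0// distrC ger0_norm ?subr_ge0//.
have := matrix_saddle_mixed S' S.
case: S => _ /andP[q0 q1] _ _; case: S' => /andP[p0 p1] _ _ _.
have : (1 - p') * (1 - q) * (w' - w) <= 1 * (w' - w).
  by apply: ler_wpM2r; [lra|apply: mulr_ile1; lra].
lra.
Qed.

Lemma matrix_saddle_bound f g h w v p q : matrix_saddle f g h w v p q ->
  `|v| <= `|f| + `|g| + `|h|.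
Proof.
move=> [/andP[p0 p1] /andP[q0 q1] [vhg _] [hfv _]].
have := ler_norm f; have := ler_norm g; have := ler_norm h.
have := lerNnormlW (lexx `|f|); have := lerNnormlW (lexx `|g|).
have := lerNnormlW (lexx `|h|).
rewrite ler_norml; move: `|f| `|g| `|h| => F G H.
move=> Hh Gg Ff hH gG fF.
have e1 := ler_wpM2l p0 hH; have e2 : (1 - p) * g <= (1 - p) * G.
  by apply: ler_wpM2l => //; lra.
have e3 := ler_wpM2l q0 Hh; have e4 : (1 - q) * - F <= (1 - q) * f.
  by apply: ler_wpM2l => //; lra.
have H0 : 0 <= H by lra.
have G0 : 0 <= G by lra.
have F0 : 0 <= F by lra.
have : p * H <= 1 * H by exact: ler_wpM2r.
have : q * H <= 1 * H by exact: ler_wpM2r.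
have : 0 <= p * G by rewrite mulr_ge0.
have : 0 <= q * F by rewrite mulr_ge0.
by move=> *; apply/andP; split; lra.
Qed.

(** The probabilities to stop prescribed on B_1, ..., B_8, as a case
    distinction in the order in which those sets are cut out. *)
Definition optimal_stop f g h w : R * R :=
  if g <= h <= f then (1, 1)
  else if f <= h <= g then
    if w < f then (1, 0) else if w <= g then (0, 0) else (0, 1)
  else if f <= w <= g then (0, 0)
  else if (h < Num.min f g) && (g <= w) then (0, 1)
  else if (h > Num.max f g) && (w <= f) then (1, 0)
  else ((g - w) / (f - h - w + g), (f - w) / (f - h - w + g)).

Lemma med_clamp f g w : f <= g ->
  med f g w = if w < f then f else if w <= g then w else g.
Proof.
rewrite /med => fg; rewrite (max_r fg); case: ifPn => [/ltW wf|].
  by rewrite (max_l wf) (max_l (le_trans wf fg)) (min_l fg) (min_r fg).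
rewrite -leNgt => fw; rewrite (max_r fw); case: ifPn => [wg|].
  by rewrite (max_l wg) (min_l wg) (min_r wg).
by rewrite -ltNge => /ltW gw; rewrite (max_r gw) minxx (min_l gw).
Qed.

Lemma notin_hull f g h : ~~ (g <= h <= f) -> ~~ (f <= h <= g) ->
  h < Num.min f g \/ Num.max f g < h.
Proof.
rewrite lt_min gt_max => ? ?; have [hf|fh] := ltP h f.
  by left; lra.
by right; lra.
Qed.

Lemma matrix_saddle_W f g h w :
  matrix_saddle f g h w (W f g h w)
    (optimal_stop f g h w).1 (optimal_stop f g h w).2.
Proof.
have saddleI v p q : 0 <= p <= 1 -> 0 <= q <= 1 ->
    v <= p * h + (1 - p) * g -> v <= p * f + (1 - p) * w ->
    q * h + (1 - q) * f <= v -> q * g + (1 - q) * w <= v ->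
    matrix_saddle f g h w v p q by [].
have [Wstop Wmed Wcont [Wg Wf Wmix]] := W_cases f g h w.
have Wex := W_exhaustive f g h w.
rewrite /optimal_stop; case: ifPn => [ghf|nghf].
  by rewrite Wstop//; apply: saddleI => /=; lra.
case: ifPn => [fhg|nfhg].
  rewrite Wmed// med_clamp; last lra.
  by case: ifPn => ?; [|case: ifPn => ?]; apply: saddleI => /=; lra.
rewrite (negbTE nghf) (negbTE nfhg) in Wex.
have hout := notin_hull nghf nfhg.
case: ifPn => [fwg|nfwg].
  rewrite Wcont//; move: hout; rewrite lt_min gt_max => hout.
  by apply: saddleI => /=; lra.
case: ifPn => [/andP[hfg gw]|nWg].
  rewrite Wg//; move: hfg; rewrite lt_min => hfg.
  by apply: saddleI => /=; lra.
case: ifPn => [/andP[hfg wf]|nWf].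
  rewrite Wf//; move: hfg; rewrite gt_max => hfg.
  by apply: saddleI => /=; lra.
have mix : Num.max f g < Num.min h w \/ Num.max h w < Num.min f g.
  case: Wex => // [/andP[_ fwg]|[gw|wf|/orP//]].
  - by rewrite fwg in nfwg.
  - by rewrite gw in nWg.
  - by rewrite wf in nWf.
rewrite Wmix//; set D := f - h - w + g.
have -> : g - h + f - w = D by rewrite /D; lra.
(* D = (f - h) + (g - w), and both differences have the same strict sign. *)
have D0 : D != 0.
  by rewrite /D; move: mix; rewrite !lt_min !gt_max => mix; apply/eqP; lra.
have p1 : 1 - (g - w) / D = (f - h) / D by rewrite /D; field.
have q1 : 1 - (f - w) / D = (g - h) / D by rewrite /D; field.
have p01 : 0 <= (g - w) / D /\ 0 <= (f - h) / D /\
    0 <= (f - w) / D /\ 0 <= (g - h) / D.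
  have [neg|pos] := mix; move: mix => _.
    by rewrite -![_ / D]mulrNN -!invrN; repeat split; apply: mulr_ge0;
      rewrite ?invr_ge0;
     move: neg; rewrite lt_min !gt_max /D; lra.
  by repeat split; apply: mulr_ge0; rewrite ?invr_ge0;
     move: pos; rewrite lt_min !gt_max /D; lra.
apply: saddleI => /=; rewrite ?p1 ?q1.
- by rewrite -p1 in p01; lra.
- by rewrite -q1 in p01; lra.
- by rewrite le_eqVlt; apply/orP; left; apply/eqP; rewrite /D; field.
- by rewrite le_eqVlt; apply/orP; left; apply/eqP; rewrite /D; field.
- by rewrite le_eqVlt; apply/orP; left; apply/eqP; rewrite /D; field.
- by rewrite le_eqVlt; apply/orP; left; apply/eqP; rewrite /D; field.
Qed.

End matrix_game.

(** The cases of [optimal_stop] are tested in the order of the B_i, so failing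
    the earlier tests is what membership in the set difference B_i requires. *)
Lemma saddle_choice_optimal_stop (R : realType) (E : Type)
    (f g h w p1 p2 : E -> R) :
  saddle_choice f g h w p1 p2 -> forall x,
  (p1 x, p2 x) = optimal_stop (f x) (g x) (h x) (w x).
Proof.
move=> choice x; have [[c1 c2 c3 c4] [c5 c6 c7 c8]] := choice x.
have eqp (a b : R) : p1 x = a /\ p2 x = b -> (p1 x, p2 x) = (a, b).
  by case=> -> ->.
have Wex := W_exhaustive (f x) (g x) (h x) (w x).
rewrite /optimal_stop; case: ifPn => [/c1/eqp//|N1].
have nB1 : ~ B1 f g h x by exact/negP.
case: ifPn => [fhg|N2].
  case: ifPn => [wf|wf]; first by apply/eqp/c2; split.
  have nB2 : ~ B2 f g h w x by case=> -[_ ?]; lra.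
  case: ifPn => [wg|wg]; apply/eqp; [apply: c3|apply: c4].
    by split; [split=> //; lra|case].
  have nB3 : ~ B3 f g h w x by case=> -[_ ?]; lra.
  by split; [split=> //; lra|case=> // -[]].
have nB2 : ~ B2 f g h w x by case=> -[?]; lra.
have nB3 : ~ B3 f g h w x by case=> -[?]; lra.
have nB4 : ~ B4 f g h w x by case=> -[?]; lra.
rewrite (negbTE N1) (negbTE N2) in Wex.
have hout := notin_hull N1 N2.
case: ifPn => [fwg|N5].
  by apply/eqp/c5; split=> // -[[[]|]|].
have nB5 : ~ B5 f g h w x by case=> -[_ fwg]; rewrite fwg in N5.
case: ifPn => [/andP[hfg gw]|N6].
  by apply/eqp/c6; split=> // -[[[[]|]|]|].
have nB6 : ~ B6 f g h w x.
  by case=> -[hfg gw] _; rewrite hfg gw in N6.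
case: ifPn => [/andP[hfg wf]|N7].
  by apply/eqp/c7; split=> // -[[[[[]|]|]|]|].
have nB7 : ~ B7 f g h w x.
  by case=> -[hfg gw] _; rewrite hfg gw in N7.
apply/eqp/c8; split; last by case=> [[[[[[]|]|]|]|]|].
case: Wex => // [/andP[_ fwg]|[gw|wf|/orP//]].
- by rewrite fwg in N5.
- by rewrite gw in N6.
- by rewrite wf in N7.
Qed.

(** * Independence of the past *)

Section independence_tools.
Context d (T : measurableType d) (R : realType).
Local Open Scope ereal_scope.

(** The form in which independence enters integrals: if [A] only rescales the
    law of [Y] on [A'], it only rescales the integrals of functions of [Y]. *)
Lemma ge0_integral_scaled_law (Q : probability T R) dS (S : measurableType dS)
    (A A' : set T) (mA : measurable A) (mA' : measurable A') (c : {nonneg R})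
    (Y : T -> S) (F : S -> \bar R) :
  measurable_fun setT Y ->
  (forall B, measurable B ->
    Q (A `&` Y @^-1` B) = c%:num%:E * Q (A' `&` Y @^-1` B)) ->
  measurable_fun setT F -> (forall s, 0 <= F s) ->
  \int[Q]_(w in A) F (Y w) = c%:num%:E * \int[Q]_(w in A') F (Y w).
Proof.
move=> mY QY mF F0.
have mFY : measurable_fun setT (fun w => F (Y w)) by exact: measurableT_comp.
rewrite -(ge0_integral_mrestr Q mA)// -(ge0_integral_mrestr Q mA')//.
rewrite -[LHS](@giry_int_map _ _ _ _ R Y mY (restricted_probability Q mA))//.
rewrite -[X in _ * X](@giry_int_map _ _ _ _ R Y mY
  (restricted_probability Q mA'))//.
rewrite /giry_int -ge0_integral_mscale//.
apply: eq_measure_integral => B mB _.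
transitivity (Q (A `&` Y @^-1` B)); first by rewrite setIC.
rewrite QY// setIC; exact: erefl.
Qed.

Section density.
Variables (mu : {measure set T -> \bar R}) (F : T -> \bar R).
Hypotheses (mF : measurable_fun setT F) (F0 : forall w, 0 <= F w).

(** The measure with density [F] with respect to [mu]; the two proofs are
    parameters so that the measure structure can be attached to it. *)
Definition density of measurable_fun setT F & (forall w, 0 <= F w) :
  set T -> \bar R := fun A => \int[mu]_(w in A) F w.
Local Notation nu := (density mF F0).

Let density0 : nu set0 = 0. Proof. by rewrite /density integral_set0. Qed.

Let density_ge0 A : 0 <= nu A. Proof. exact: integral_ge0. Qed.

Let density_sigma_additive : semi_sigma_additive nu.
Proof.
move=> /= D mD tD mUD; apply: cvg_toP.
  apply: ereal_nondecreasing_is_cvgn => m n mn.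
  by apply: lee_sum_nneg_natr => // k _ _; exact: density_ge0.
by rewrite /density ge0_integral_bigcup//; exact: measurable_funTS.
Qed.

HB.instance Definition _ := isMeasure.Build _ _ _ nu
  density0 density_ge0 density_sigma_additive.

End density.

(** The cylinders over the first [n] sigma-algebras form a pi-system that
    generates their past, and they are independent of the [n]-th one by
    assumption. *)
Lemma indep_past (Q : probability T R) (G : nat -> set_system T) n :
  (forall k, G k `<=` measurable) -> (forall k, setI_closed (G k)) ->
  (forall k, G k setT) -> mutually_independent Q G ->
  forall A C, <<s \bigcup_(k in [set k | (k < n)%N]) G k >> A -> G n C ->
  Q (A `&` C) = Q A * Q C.
Proof.
move=> Gm GI GT indepG A C GA GnC.
pose cyl := [set D | exists2 B : nat -> set T, (forall k, G k (B k)) &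
  D = \bigcap_(k in [set` iota 0 n]) B k].
have cylm : cyl `<=` measurable.
  by move=> _ [B GB ->]; apply: fin_bigcap_measurable => // k _; exact/Gm.
apply: (@indep_generated _ _ _ Q cyl) => //.
- move=> _ _ [B GB ->] [B' GB' ->]; rewrite -bigcapI.
  by exists (fun k => B k `&` B' k) => // k; exact: GI.
- by exists (fun=> setT) => //; rewrite bigcapT.
- exact: Gm GnC.
- move=> _ [B GB ->]; pose B' k := if k == n then C else B k.
  have GB' k : G k (B' k) by rewrite /B'; case: eqP => [->|].
  have BB' k : (k < n)%N ->
    B' k = B k by rewrite /B' ltn_neqAle => /andP[/negbTE->].
  have -> : (\bigcap_(k in [set` iota 0 n]) B k) `&` C =
      \bigcap_(k in [set` iota 0 n.+1]) B' k.
    apply/seteqP; split => w.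
      move=> [BC Cw] k; rewrite /mkset mem_iota add0n ltnS
        [X in is_true X]leq_eqVlt => /orP[/eqP->|kn].
        by rewrite /B' eqxx.
      by rewrite BB'//; apply: BC; rewrite /mkset mem_iota.
    move=> Bw; split=> [k|].
      rewrite /mkset mem_iota add0n => /andP[_ kn]; rewrite -BB'//; apply: Bw.
      by rewrite /mkset mem_iota add0n ltnS/=; exact: ltnW.
    by have := Bw n; rewrite /mkset mem_iota/= /B' eqxx; apply; rewrite ltnS.
  rewrite (mutually_independent_seq indepG)//; last exact: iota_uniq.
  rewrite -[in iota 0 n.+1]addn1 iotaD big_cat/= big_seq1/= {2}/B' eqxx.
  rewrite (mutually_independent_seq indepG)//; last exact: iota_uniq.
  by congr (_ * _); rewrite !big_seq; apply: eq_bigr => k;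
    rewrite mem_iota => /BB'->.
- apply: (smallest_sub _ _ GA) => [|D [k /= kn GD]];
    first exact: smallest_sigma_algebra.
  apply: sub_sigma_algebra; exists (fun j => if j == k then D else setT).
    by move=> j; case: eqP => [->|].
  apply/seteqP; split => [w Dw j _|w].
    by case: eqP => //.
  by move=> /(_ k)/=; rewrite eqxx; apply; rewrite /mkset mem_iota.
Qed.

End independence_tools.

(** * The sigma-algebras generated by the sources *)

Section sigma_of_theory.
Context {dO dF : measure_display} {Omega : measurableType dO}
        {F : measurableType dF}.
Variable Y : nat -> {mfun Omega >-> F}.
Implicit Types (D : set nat) (A : set Omega).

Lemma sigma_algebra_sigma_of D : sigma_algebra setT (sigma_of D (fun k => Y k)).
Proof. exact: smallest_sigma_algebra. Qed.

Lemma sigma_of_setT D : sigma_of D (fun k => Y k) setT.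
Proof.
exact: (@measurableT _ (g_sigma_algebraType
  (\bigcup_(k in D) preimage_set_system setT (Y k) measurable))).
Qed.

Lemma sigma_of_setI D : setI_closed (sigma_of D (fun k => Y k)).
Proof.
move=> A B DA DB.
exact: (@measurableI _ (g_sigma_algebraType
  (\bigcup_(k in D) preimage_set_system setT (Y k) measurable))).
Qed.

Lemma sub_sigma_of D D' : D `<=` D' ->
  sigma_of D (fun k => Y k) `<=` sigma_of D' (fun k => Y k).
Proof.
move=> DD'; apply: smallest_sub; first exact: sigma_algebra_sigma_of.
move=> A [k /DD' D'k YA]; apply: sub_sigma_algebra; by exists k.
Qed.

Lemma sigma_of_measurable D : sigma_of D (fun k => Y k) `<=` measurable.
Proof.
apply: smallest_sub; first exact: sigma_algebra_measurable.
by move=> _ [k _ [B mB <-]]; rewrite setTI -[_ @^-1` _]setTI;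
  exact: measurable_funP.
Qed.

Lemma sigma_of_preimage D k B : D k -> measurable B ->
  sigma_of D (fun k => Y k) (Y k @^-1` B).
Proof.
move=> Dk mB; apply: sub_sigma_algebra; exists k => //.
by exists B => //; rewrite setTI.
Qed.

End sigma_of_theory.

Section rectangles.
Context {Omega : Type}.
Implicit Types GX GA GB : set_system Omega.

(** The pi-system of rectangles, which generates the joint sigma-algebra and on
    which independence of the three sources factors probabilities. *)
Definition rect3 GX GA GB : set_system Omega :=
  [set D | exists DX DA DB, [/\ GX DX, GA DA, GB DB & D = DX `&` DA `&` DB]].

Lemma rect3_setI GX GA GB : setI_closed GX -> setI_closed GA ->
  setI_closed GB -> setI_closed (rect3 GX GA GB).
Proof.
move=> GXI GAI GBI _ _ [DX [DA [DB [X1 A1 B1 ->]]]]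
  [DX' [DA' [DB' [X2 A2 B2 ->]]]].
exists (DX `&` DX'), (DA `&` DA'), (DB `&` DB').
by split; [exact: GXI|exact: GAI|exact: GBI|rewrite setIACA (setIACA DX)].
Qed.

Lemma sub_rect3 GX GA GB : GX setT -> GA setT -> GB setT ->
  [/\ GX `<=` rect3 GX GA GB, GA `<=` rect3 GX GA GB & GB `<=` rect3 GX GA GB].
Proof.
move=> GXT GAT GBT; split=> D GD.
- by exists D, setT, setT; rewrite !setIT.
- by exists setT, D, setT; rewrite setIT setTI.
- by exists setT, setT, D; rewrite !setTI.
Qed.

End rectangles.

Section independence_of_sources.
Context {R : realType} {dE dO : measure_display} {E : measurableType dE}
  {Omega : measurableType dO}.
Variables (Q : probability Omega R) (X : nat -> {mfun Omega >-> E})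
  (xi1 xi2 : nat -> {mfun Omega >-> R}) (T : {mfun Omega >-> nat}).
Local Open Scope ereal_scope.

Definition independent_triple (xi eta : nat -> {mfun Omega >-> R}) : Prop :=
  forall DX DA DB, sigma_of setT (fun k => X k) DX ->
    sigma_of setT (fun k => xi k) DA -> sigma_of setT (fun k => eta k) DB ->
  Q (DX `&` DA `&` DB) = Q DX * Q DA * Q DB.

Lemma independent_tripleC xi eta :
  independent_triple xi eta -> independent_triple eta xi.
Proof.
by move=> ind DX DA DB sX sA sB; rewrite -setIA (setIC DA) setIA ind// muleAC.
Qed.

Lemma independent_sources_triple :
  independent_sources X xi1 xi2 T Q -> independent_triple xi1 xi2.
Proof.
move=> ind DX DA DB sX sA sB.
pose o k (k4 : (k < 4)%N) : 'I_4 := Ordinal k4.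
have := @mutually_independent_seq _ _ _ Q _ _
  [:: o 0%N isT; o 1%N isT; o 2%N isT] (fun i => nth set0 [:: DX; DA; DB] i)
    ind isT.
rewrite !big_cons big_nil/= mule1 muleA => <-.
  congr (Q _); apply/seteqP; split=> [w [[? ?] ?] i|w dw].
    by rewrite /mkset !inE => /or3P[]/eqP->.
  by split; [split|]; [apply: (dw (o 0%N isT))|apply: (dw (o 1%N isT))|
    apply: (dw (o 2%N isT))]; rewrite /mkset !inE.
by move=> i; rewrite !inE => /or3P[]/eqP->.
Qed.

Lemma independent_sources_time A k :
  independent_sources X xi1 xi2 T Q -> sigma_of setT (fun k => X k) A ->
  Q (T @^-1` [set k] `&` A) = Q (T @^-1` [set k]) * Q A.
Proof.
move=> ind sA.
pose o k (k4 : (k < 4)%N) : 'I_4 := Ordinal k4.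
have := @mutually_independent_seq _ _ _ Q _ _
  [:: o 3%N isT; o 0%N isT]
  (fun i => nth set0 [:: A; set0; set0; T @^-1` [set k]] i) ind isT.
rewrite !big_cons big_nil/= mule1 => <-.
  congr (Q _); apply/seteqP; split=> [w [? ?] i|w dw].
    by rewrite /mkset !inE => /orP[]/eqP->.
  by split; [apply: (dw (o 3%N isT))|apply: (dw (o 0%N isT))];
    rewrite /mkset !inE.
move=> i; rewrite !inE => /orP[]/eqP-> //=.
by exists [set k] => //; rewrite setTI.
Qed.

End independence_of_sources.

Section conditioning.
Context {R : realType} {dE dO : measure_display} {E : measurableType dE}
  {Omega : measurableType dO}.
Variables (Pi : R.-pker E ~> E) (Q : probability Omega R)
  (X : nat -> {mfun Omega >-> E}) (xi eta : nat -> {mfun Omega >-> R}).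
Local Open Scope ereal_scope.
Hypothesis ind : independent_triple Q X xi eta.

(** What is known just before the opponent draws [eta n]. All of [X] and [xi]
    is included, since [eta n] is independent even of their future. *)
Definition before_draw n : set_system Omega :=
  rect3 (sigma_of setT (fun k => X k)) (sigma_of setT (fun k => xi k))
        (sigma_of [set k | (k < n)%N] (fun k => eta k)).

(** What is known just before the chain moves to [X n.+1]. All of [xi] and
    [eta] is included, since they are independent of the whole chain. *)
Definition up_to_now n : set_system Omega :=
  rect3 (sigma_of [set k | (k <= n)%N] (fun k => X k))
        (sigma_of setT (fun k => xi k)) (sigma_of setT (fun k => eta k)).

Lemma rect3_measurable DX DA DB :
  rect3 (sigma_of DX (fun k => X k)) (sigma_of DA (fun k => xi k))
    (sigma_of DB (fun k => eta k)) `<=` measurable.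
Proof.
move=> _ [AX [AA [AB [sX sA sB ->]]]].
apply: measurableI; [apply: measurableI|].
- exact: sigma_of_measurable sX.
- exact: sigma_of_measurable sA.
- exact: sigma_of_measurable sB.
Qed.

Hypothesis iid_eta : iid_uniform01 eta Q.

Lemma sub_before_draw n : [/\ sigma_of setT (fun k => X k) `<=` before_draw n,
  sigma_of setT (fun k => xi k) `<=` before_draw n &
  sigma_of [set k | (k < n)%N] (fun k => eta k) `<=` before_draw n].
Proof. by apply: sub_rect3; exact: sigma_of_setT. Qed.

Lemma before_draw_indep n A C : <<s before_draw n >> A -> measurable C ->
  Q (A `&` eta n @^-1` C) = Q A * uniform_prob (@ltr01 R) C.
Proof.
move=> GA mC; have [lawU indU] := iid_eta; rewrite -(lawU n)//.
have mU : measurable (eta n @^-1` C).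
  by rewrite -[_ @^-1` _]setTI; exact: measurable_funP.
have sU : sigma_of setT (fun k => eta k) (eta n @^-1` C).
  exact: sigma_of_preimage.
apply: (@indep_generated _ _ _ Q (before_draw n)) => //.
- exact: rect3_measurable.
- by apply: rect3_setI; exact: sigma_of_setI.
- by have [s _ _] := sub_before_draw n; apply: s; exact: sigma_of_setT.
move=> _ [DX [DA [DB [sX sA sB ->]]]].
have sB' : sigma_of setT (fun k => eta k) DB by apply: sub_sigma_of sB.
rewrite -setIA ind//; last exact: sigma_of_setI.
rewrite ind// -[RHS]muleA; congr (_ * _).
apply: (@indep_past _ _ _ Q
  (fun k => preimage_set_system setT (eta k) measurable) n) => //.
- move=> k _ [B mB <-]; rewrite setTI -[_ @^-1` _]setTI; exact: measurable_funP.
- move=> k _ _ [B mB <-] [B' mB' <-]; exists (B `&` B');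
    first exact: measurableI.
  by rewrite !setTI.
- by move=> k; exists setT => //; rewrite setTI.
- by exists C => //; rewrite setTI.
Qed.

Hypothesis markovX : forall n D A,
  sigma_of [set k | (k <= n)%N] (fun k => X k) D -> measurable A ->
  Q (D `&` X n.+1 @^-1` A) = \int[Q]_(om in D) Pi (X n om) A.

(** The Markov property survives the enlargement of the history of [X] by the
    randomization sources: on a rectangle, both sides pick up the factor [Q DA
    * Q DB]. *)
Lemma up_to_now_markov n A B : <<s up_to_now n >> A -> measurable B ->
  Q (A `&` X n.+1 @^-1` B) = \int[Q]_(w in A) Pi (X n w) B.
Proof.
move=> GA mB.
have mXB : measurable (X n.+1 @^-1` B).
  by rewrite -[_ @^-1` _]setTI; exact: measurable_funP.
have mPi : measurable_fun setT (fun y => Pi y B) by exact: measurable_kernel.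
have mPiX : measurable_fun setT (fun w => Pi (X n w) B).
  by apply: measurableT_comp mPi _; exact: measurable_funP.
have Pi0 w : 0 <= Pi (X n w) B by exact: measure_ge0.
apply: (@eq_measure_generated _ _ _ (up_to_now n) (mrestr Q mXB)
  (density Q mPiX Pi0)) GA => //.
- exact: rect3_measurable.
- by apply: rect3_setI; exact: sigma_of_setI.
- have [s _ _] := sub_rect3
    (@sigma_of_setT _ _ _ _ X [set k | (k <= n)%N])
    (@sigma_of_setT _ _ _ _ xi setT) (@sigma_of_setT _ _ _ _ eta setT).
  by apply: s; exact: sigma_of_setT.
- by rewrite /= /mrestr setTI -ge0_fin_numE ?fin_num_measure.
move=> _ [DX [DA [DB [sX sA sB ->]]]].
have mD := sigma_of_measurable sX.
have mA := sigma_of_measurable sA; have mB' := sigma_of_measurable sB.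
have mD3 : measurable (DX `&` DA `&` DB).
  by apply: (@rect3_measurable [set k | (k <= n)%N] setT setT);
    exists DX, DA, DB.
have sXT : sigma_of setT (fun k => X k) DX by exact: sub_sigma_of sX.
have QAB0 : (0 <= fine (Q DA * Q DB))%R by rewrite fine_ge0// mule_ge0.
have QABE : (NngNum QAB0)%:num%:E = Q DA * Q DB.
  by rewrite fineK// fin_numM// fin_num_measure.
transitivity (Q (DX `&` DA `&` DB `&` X n.+1 @^-1` B)) => //.
rewrite /= /density (@ge0_integral_scaled_law _ _ _ Q _ _ _ _ mD3 mD
  (NngNum QAB0) (X n) (fun y => Pi y B))//.
  rewrite -markovX// QABE
    [LHS](_ : _ = Q ((DX `&` X n.+1 @^-1` B) `&` DA `&` DB)).
    rewrite ind//; last by apply: sigma_of_setI => //; exact: sigma_of_preimage.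
    by rewrite -muleA muleC.
  by congr (Q _); rewrite setIAC (setIAC DX).
move=> C mC; rewrite QABE [LHS](_ : _ = Q ((DX `&` X n @^-1` C) `&` DA `&` DB)).
  rewrite ind//; last by apply: sigma_of_setI => //; exact: sigma_of_preimage.
  by rewrite -muleA muleC.
by congr (Q _); rewrite setIAC (setIAC DX).
Qed.

End conditioning.

(** * Drawing a coin and moving the chain *)

Lemma uniform_prob_le (R : realType) (p : R) : 0 <= p <= 1 ->
  uniform_prob (@ltr01 R) [set u | u <= p] = p%:E.
Proof.
move=> /andP[p0 p1]; rewrite /uniform_prob integral_uniform_pdf.
have -> : [set u | u <= p] `&` `[0, 1]%classic = `[0, p]%classic.
  apply/seteqP; split=> u /=; rewrite !in_itv/=.
    by move=> [-> /andP[-> _]].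
  by move=> /andP[-> up]; rewrite up (le_trans up).
rewrite (eq_integral (cst 1%E)) => [|u]; last first.
  rewrite inE/= in_itv/= => /andP[u0 up].
  by rewrite /uniform_pdf u0 (le_trans up)// subr0 invr1.
rewrite integral_cst//= mul1e lebesgue_measure_itv/= lte_fin.
by case: ifPn => [_|]; rewrite ?oppr0 ?adde0// -leNgt => p0'; congr EFin; lra.
Qed.

Lemma Rintegral_posneg d (T : measurableType d) (R : realType)
    (mu : {measure set T -> \bar R}) (D : set T) (f : T -> R) :
  measurable D -> mu.-integrable D (EFin \o f) ->
  \int[mu]_(x in D) f x =
  \int[mu]_(x in D) f^\+ x - \int[mu]_(x in D) f^\- x.
Proof.
move=> mD intf; rewrite -RintegralB//.
- by apply: eq_Rintegral => x _; rewrite -[in LHS](funrposBneg f).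
- exact: integrable_funrpos.
- exact: integrable_funrneg.
Qed.

Lemma integrable_dominated d (T : measurableType d) (R : realType)
    (mu : {measure set T -> \bar R}) (u v : T -> R) :
  measurable_fun setT u -> (forall x, `|u x| <= v x) ->
  mu.-integrable setT (EFin \o v) -> mu.-integrable setT (EFin \o u).
Proof.
move=> mu' uv; apply: le_integrable => //; first exact/measurable_EFinP.
by move=> x _; rewrite /= lee_fin (le_trans (uv x))// ler_norm.
Qed.

Lemma measurable_Rintegral_kernel (R : realType) (dE : measure_display)
    (E : measurableType dE) (Pi : R.-pker E ~> E) (G : E -> R) :
  measurable_fun setT G -> measurable_fun setT (fun y => \int[Pi y]_z G z).
Proof.
move=> mG; apply: (measurableT_comp (@fine_measurable R setT measurableT)).
have mpos (H : E -> \bar R) : measurable_fun setT H -> (forall y, 0 <= H y)%E ->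
    measurable_fun setT (fun y => \int[Pi y]_z H z)%E.
  move=> mH H0; apply: measurable_fun_integral_kernel => // U mU.
  exact: measurable_kernel.
have mG' : measurable_fun setT (EFin \o G) by exact/measurable_EFinP.
under eq_fun do rewrite integralE.
by apply: emeasurable_funB; apply: mpos => //;
  [exact: measurable_funepos|exact: measurable_funeneg].
Qed.

Section kernel_law.
Context {R : realType} {dE : measure_display} {E : measurableType dE}.
Variables (Pi : R.-pker E ~> E) (y : E).

(** The law [Pi y], packed as a point of the Giry monad. *)
Definition kernel_law : set E -> \bar R := Pi y.

HB.instance Definition _ := Measure.on kernel_law.

Let kernel_law_setT : (kernel_law setT <= 1)%E.
Proof. by rewrite /kernel_law prob_kernel. Qed.

HB.instance Definition _ :=
  Measure_isSubProbability.Build _ _ _ kernel_law kernel_law_setT.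

End kernel_law.

Section conditional_expectations.
Context {R : realType} {dE dO : measure_display} {E : measurableType dE}
  {Omega : measurableType dO}.
Variables (Pi : R.-pker E ~> E) (Q : probability Omega R)
  (X : nat -> {mfun Omega >-> E}) (xi eta : nat -> {mfun Omega >-> R}).
Hypothesis ind : independent_triple Q X xi eta.
Hypothesis iid_eta : iid_uniform01 eta Q.
Hypothesis markovX : forall n D A,
  sigma_of [set k | (k <= n)%N] (fun k => X k) D -> measurable A ->
  Q (D `&` X n.+1 @^-1` A) = (\int[Q]_(om in D) Pi (X n om) A)%E.

Lemma before_draw_measurable n : <<s before_draw X xi eta n >> `<=` measurable.
Proof.
apply: smallest_sub; first exact: sigma_algebra_measurable.
exact: rect3_measurable.
Qed.

Lemma up_to_now_measurable n : <<s up_to_now X xi eta n >> `<=` measurable.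
Proof.
apply: smallest_sub; first exact: sigma_algebra_measurable.
exact: rect3_measurable.
Qed.

Definition stops (p : E -> R) n : set Omega := [set w | eta n w <= p (X n w)].

Lemma measurable_stops p n : measurable_fun setT p -> measurable (stops p n).
Proof.
move=> mp.
have /(_ measurableT [set true]) :
  measurable_fun setT (fun w => eta n w <= p (X n w)).
  by apply: measurable_fun_ler => //; exact: measurableT_comp.
rewrite setTI; exact.
Qed.

Section draw.
Variables (p : E -> R).
Hypothesis rp : randomization p.

(** Given [X n], the opponent stops with probability [p (X n)], whatever
    happened in [A]. *)
Lemma ge0_integral_draw n A (F : E -> \bar R) :
  <<s before_draw X xi eta n >> A -> measurable_fun setT F ->
    (forall y, 0 <= F y)%E ->
  (\int[Q]_(w in A `&` stops p n) F (X n w) =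
   \int[Q]_(w in A) ((p (X n w))%:E * F (X n w)))%E.
Proof.
move=> GA mF F0; have [mp p01] := rp.
have mA := before_draw_measurable GA.
pose H (s : E * R) : \bar R :=
  (F s.1 * (\1_[set s : E * R | s.2 <= p s.1] s)%:E)%E.
have mle : measurable [set s : E * R | s.2 <= p s.1].
  have /(_ measurableT [set true]) :
    measurable_fun setT (fun s : E * R => s.2 <= p s.1).
    by apply: measurable_fun_ler => //; exact: measurableT_comp.
  rewrite setTI; exact.
have mH : measurable_fun setT H.
  apply: emeasurable_funM; first exact: measurableT_comp.
  by apply/measurable_EFinP; exact: measurable_indic.
have H0 s : (0 <= H s)%E by rewrite mule_ge0// lee_fin.
transitivity (\int[Q]_(w in A) H (X n w, eta n w))%E.
  rewrite integral_mkcondr; apply: eq_integral => w _.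
  rewrite /H patchE /= indicE; case: ifPn.
    by rewrite inE => Sw; rewrite mem_set// mule1.
  by rewrite notin_setE => Sw; rewrite memNset// mule0.
rewrite (@ge0_integral_indep _ _ _ Q _ _ _ _ (uniform_prob (@ltr01 R)))//.
  apply: eq_integral => w _; rewrite /H /= ge0_integralZl//; last first.
    have mi : measurable_fun setT
      (\1_[set s : E * R | s.2 <= p s.1] : E * R -> R)
  by exact: measurable_indic.
    apply/measurable_EFinP.
    apply: (@measurableT_comp _ _ _ _ _ _ _ _ (fun u => (X n w, u)) mi).
    exact: measurable_fun_pair.
  rewrite muleC; congr (_ * _)%E; rewrite -(uniform_prob_le (p01 (X n w))).
  have mpw : measurable [set u : R | u <= p (X n w)].
    by rewrite -set_itvNyc; exact: measurable_itv.
  transitivity (\int[uniform_prob (@ltr01 R)]_u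
      (\1_[set u | u <= p (X n w)] u)%:E)%E.
    by apply: eq_integral => u _; rewrite !indicE; congr (nat_of_bool _)%:R%:E;
      apply/idP/idP; rewrite !inE.
  by rewrite integral_indic// setIT.
  exact: (measurable_funP (eta n)).
move=> B C mB mC; apply: (before_draw_indep ind iid_eta) => //.
apply: (@measurableI _ (g_sigma_algebraType (before_draw X xi eta n))) => //.
apply: sub_sigma_algebra.
have [s _ _] := sub_before_draw X xi eta n; apply: s.
exact: sigma_of_preimage.
Qed.

End draw.

Lemma ge0_integral_transition n A (F : E -> \bar R) :
  <<s up_to_now X xi eta n >> A -> measurable_fun setT F ->
    (forall y, 0 <= F y)%E ->
  (\int[Q]_(w in A) F (X n.+1 w) = \int[Q]_(w in A) \int[Pi (X n w)]_y F y)%E.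
Proof.
move=> GA mF F0; have mA := up_to_now_measurable GA.
have mX : measurable_fun setT (X n) by exact: (measurable_funP (X n)).
apply: (@disintegration _ _ _ Q _ _ _ mA (X n.+1)
  (fun w => kernel_law Pi (X n w)) F) => //.
- move=> C mC; exact: (measurableT_comp (measurable_kernel Pi C mC) mX).
- move=> C mC; exact: (up_to_now_markov ind markovX).
Qed.

Lemma integrable_draw n A (p F : E -> R) : randomization p ->
  measurable A -> measurable_fun setT F ->
  Q.-integrable setT (EFin \o (F \o X n)) ->
  Q.-integrable A (EFin \o (fun w => p (X n w) * F (X n w))).
Proof.
move=> [mp p01] mA mF iF.
apply: (@le_integrable _ _ _ Q A mA _ (EFin \o (F \o X n))).
- apply/measurable_EFinP; apply: measurable_funTS; apply: measurable_funM.
    exact: measurableT_comp.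
  exact: measurableT_comp.
- move=> w _; rewrite /= lee_fin normrM ler_piMl//.
  by have /andP[? ?] := p01 (X n w); rewrite ger0_norm.
- exact: integrableS iF.
Qed.

Lemma Rintegral_draw n A (p F : E -> R) : randomization p ->
  <<s before_draw X xi eta n >> A -> measurable_fun setT F ->
  Q.-integrable setT (EFin \o (F \o X n)) ->
  \int[Q]_(w in A `&` stops p n) F (X n w) =
  \int[Q]_(w in A) (p (X n w) * F (X n w)).
Proof.
move=> rp GA mF iF; have [mp p01] := rp.
have mA := before_draw_measurable GA; have mS := measurable_stops n mp.
have pos (G : E -> R) : measurable_fun setT G -> (forall y, 0 <= G y) ->
    \int[Q]_(w in A `&` stops p n) G (X n w) =
    \int[Q]_(w in A) (p (X n w) * G (X n w)).
  move=> mG G0; congr fine.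
  rewrite (ge0_integral_draw rp GA (F := EFin \o G))//.
  exact/measurable_EFinP.
have ipF := integrable_draw rp mA mF iF.
rewrite Rintegral_posneg//; last 2 first.
- exact: measurableI.
- by apply: integrableS iF => //; exact: measurableI.
rewrite [RHS]Rintegral_posneg//; congr (_ - _).
- rewrite [LHS](pos F^\+)//; last exact: measurable_funrpos.
  apply: eq_Rintegral => w _; rewrite /funrpos/=.
  by have /andP[p0 _] := p01 (X n w); rewrite maxr_pMr// mulr0.
- rewrite [LHS](pos F^\-)//; last exact: measurable_funrneg.
  apply: eq_Rintegral => w _; rewrite /funrneg/=.
  by have /andP[p0 _] := p01 (X n w); rewrite maxr_pMr// mulr0 mulrN.
Qed.

Lemma integrable_draw_mix n A (p F G : E -> R) : randomization p ->
  measurable A ->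
  measurable_fun setT F -> Q.-integrable setT (EFin \o (F \o X n)) ->
  measurable_fun setT G -> Q.-integrable setT (EFin \o (G \o X n)) ->
  Q.-integrable A
    (EFin \o (fun w => p (X n w) * F (X n w) + (1 - p (X n w)) * G (X n w))).
Proof.
move=> rp mA mF iF mG iG.
have rq : randomization (fun y => 1 - p y).
  have [mp p01] := rp; split; first exact: measurable_funB.
  by move=> y; have := p01 y; lra.
have ipF := integrable_draw rp mA mF iF;
  have iqG := integrable_draw rq mA mG iG.
exact: (integrableD mA ipF iqG).
Qed.

(** When [F] and [G] are the two entries of a row of the matrix game, the
    right-hand side is the payoff of that row against the mixture [p]. *)
Lemma Rintegral_draw_mix n A (p F G : E -> R) : randomization p ->
  <<s before_draw X xi eta n >> A ->
  measurable_fun setT F -> Q.-integrable setT (EFin \o (F \o X n)) ->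
  measurable_fun setT G -> Q.-integrable setT (EFin \o (G \o X n)) ->
  \int[Q]_(w in A `&` stops p n) F (X n w) +
  \int[Q]_(w in A `\` stops p n) G (X n w) =
  \int[Q]_(w in A) (p (X n w) * F (X n w) + (1 - p (X n w)) * G (X n w)).
Proof.
move=> rp GA mF iF mG iG; have [mp p01] := rp.
have mA := before_draw_measurable GA; have mS := measurable_stops n mp.
have ipF := integrable_draw rp mA mF iF.
have ipG := integrable_draw rp mA mG iG.
have iGA : Q.-integrable A (EFin \o (fun w => G (X n w))) by exact: integrableS
  iG.
have split : \int[Q]_(w in A) G (X n w)
  = \int[Q]_(w in A `&` stops p n) G (X n w) +
    \int[Q]_(w in A `\` stops p n) G (X n w).
  transitivity (\int[Q]_(w in (A `&` stops p n) `|` (A `\` stops p n)) G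
    (X n w)).
    by rewrite setUIDK.
  rewrite Rintegral_setU//.
  - exact: measurableI.
  - exact: measurableD.
  - by rewrite setUIDK.
  - by apply/disj_setPRL => w [_ nS] [].
have -> : \int[Q]_(w in A `\` stops p n) G (X n w) =
    \int[Q]_(w in A) (G (X n w) - p (X n w) * G (X n w)).
  by rewrite RintegralB//; rewrite -Rintegral_draw// split; lra.
rewrite Rintegral_draw// -RintegralD//.
- by apply: eq_Rintegral => w _; lra.
- exact: (integrableB mA iGA ipG).
Qed.

Lemma ge0_Rintegral_transition n A (G : E -> R) :
  <<s up_to_now X xi eta n >> A -> measurable_fun setT G ->
    (forall y, 0 <= G y) ->
  Q.-integrable setT (EFin \o (G \o X n.+1)) ->
  (forall y, (Pi y).-integrable setT (EFin \o G)) ->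
  Q.-integrable setT (EFin \o (fun w => \int[Pi (X n w)]_y G y)) /\
  \int[Q]_(w in A) G (X n.+1 w) = \int[Q]_(w in A) \int[Pi (X n w)]_y G y.
Proof.
move=> GA mG G0 iG iPi.
have GE y : (\int[Pi y]_z (G z)%:E)%E = (\int[Pi y]_z G z)%:E.
  by rewrite fineK//; exact: integrable_fin_num.
have mG' : measurable_fun setT (EFin \o G) by exact/measurable_EFinP.
have trans B : <<s up_to_now X xi eta n >> B ->
    (\int[Q]_(w in B) (G (X n.+1 w))%:E =
     \int[Q]_(w in B) (\int[Pi (X n w)]_y G y)%:E)%E.
  move=> GB; rewrite (ge0_integral_transition GB mG')//.
  by apply: eq_integral => w _; rewrite GE.
split; last by rewrite /Rintegral trans.
have GT : <<s up_to_now X xi eta n >> setT.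
  exact: (@measurableT _ (g_sigma_algebraType (up_to_now X xi eta n))).
apply/integrableP; split.
  apply/measurable_EFinP.
  apply: (measurableT_comp (measurable_Rintegral_kernel Pi mG)).
  exact: (measurable_funP (X n)).
have /integrableP[_] := iG; apply: le_lt_trans.
rewrite le_eqVlt; apply/orP; left; apply/eqP.
transitivity (\int[Q]_w (\int[Pi (X n w)]_y G y)%:E)%E.
  by apply: eq_integral => w _; rewrite /= ger0_norm// Rintegral_ge0.
by rewrite -trans//; apply: eq_integral => w _; rewrite /= ger0_norm.
Qed.

Lemma Rintegral_transition n A (G : E -> R) :
  <<s up_to_now X xi eta n >> A -> measurable_fun setT G ->
  Q.-integrable setT (EFin \o (G \o X n.+1)) ->
  (forall y, (Pi y).-integrable setT (EFin \o G)) ->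
  Q.-integrable setT (EFin \o (fun w => \int[Pi (X n w)]_y G y)) /\
  \int[Q]_(w in A) G (X n.+1 w) = \int[Q]_(w in A) \int[Pi (X n w)]_y G y.
Proof.
move=> GA mG iG iPi; have mA := up_to_now_measurable GA.
have [ip ep] : _ /\ _ := @ge0_Rintegral_transition n A G^\+ GA
  (measurable_funrpos mG) (funrpos_ge0 G) (integrable_funrpos measurableT iG)
  (fun y => integrable_funrpos measurableT (iPi y)).
have [im em] : _ /\ _ := @ge0_Rintegral_transition n A G^\- GA
  (measurable_funrneg mG) (funrneg_ge0 G) (integrable_funrneg measurableT iG)
  (fun y => integrable_funrneg measurableT (iPi y)).
have EG w : \int[Pi (X n w)]_y G y =
  \int[Pi (X n w)]_y G^\+ y - \int[Pi (X n w)]_y G^\- y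
  by exact: Rintegral_posneg.
split.
  under eq_fun do rewrite EG.
  exact: (integrableB measurableT ip im).
rewrite Rintegral_posneg//; last exact: integrableS iG.
rewrite [X in X - _]ep [X in _ - X]em -RintegralB//; last 2 first.
- exact: integrableS ip.
- exact: integrableS im.
by apply: eq_Rintegral => w _; rewrite EG.
Qed.

End conditional_expectations.

(** * Stopping times and the payoff of a truncated game *)

Section stopping.
Context {R : realType} {dE dO : measure_display} {E : measurableType dE}
  {Omega : measurableType dO}.
Variable X : nat -> {mfun Omega >-> E}.
Implicit Types (tau : Omega -> option nat) (zeta : nat -> {mfun Omega >-> R}).

Definition before tau n : set Omega :=
  [set w | exists2 k, tau w = Some k & (k < n)%N].

Lemma before0 tau : before tau 0 = set0.
Proof. by apply/seteqP; split => // w []. Qed.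

Lemma subset_before tau n : before tau n `<=` before tau n.+1.
Proof. by move=> w [k tk kn]; exists k => //; exact: ltnW. Qed.

Lemma before_now tau n w : before tau n.+1 w -> ~ before tau n w ->
  tau w = Some n.
Proof.
move=> [k tk]; rewrite ltnS leq_eqVlt => /orP[/eqP <-//|kn] nb.
by exfalso; apply: nb; exists k.
Qed.

Lemma not_before tau n w k : ~ before tau n w -> tau w = Some k -> (n <= k)%N.
Proof.
by move=> nb tk; rewrite leqNgt; apply/negP => kn; apply: nb; exists k.
Qed.

Lemma filtration_before zeta tau n :
  stopping_time X zeta tau -> filtration X zeta n (before tau n.+1).
Proof. by move=> /(_ n); rewrite (_ : [set om | _] = before tau n.+1). Qed.

Lemma before_markov_timeP zeta (p : E -> R) n w :
  before (markov_time X zeta p) n w <->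
    exists2 k, (k < n)%N & stops X zeta p k w.
Proof.
rewrite /before /markov_time /=; case: pselect => [ex|nex].
  split=> [[_ [<-] mn]|[k kn pk]].
    by exists (ex_minn ex) => //; case: ex_minnP.
  exists (ex_minn ex) => //; apply: leq_ltn_trans kn.
  by case: ex_minnP => m _; apply.
by split=> [[]//|[k _ pk]]; exfalso; apply: nex; exists k.
Qed.

Lemma before_markov_timeS zeta (p : E -> R) n w :
  ~ before (markov_time X zeta p) n w ->
  before (markov_time X zeta p) n.+1 w <-> stops X zeta p n w.
Proof.
move=> nb; rewrite before_markov_timeP; split=> [[k]|Sn]; last by exists n.
rewrite ltnS leq_eqVlt => /orP[/eqP <-//|kn Sk].
by exfalso; apply/nb/before_markov_timeP; exists k.
Qed.

Lemma filtration_sub zeta n (G : set_system Omega) :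
  (forall k B, (k <= n)%N -> measurable B -> <<s G >> (X k @^-1` B)) ->
  (forall k B, (k <= n)%N -> measurable B -> <<s G >> (zeta k @^-1` B)) ->
  filtration X zeta n `<=` <<s G >>.
Proof.
move=> GX Gz; apply: smallest_sub; first exact: smallest_sigma_algebra.
by move=> A [k kn [|] [B mB <-]]; rewrite setTI; [exact: GX|exact: Gz].
Qed.

Lemma generated_stops zeta (p : E -> R) k (G : set_system Omega) :
  measurable_fun setT p ->
  (forall B, measurable B -> <<s G >> (X k @^-1` B)) ->
  (forall B, measurable B -> <<s G >> (zeta k @^-1` B)) ->
  <<s G >> (stops X zeta p k).
Proof.
move=> mp GX Gz.
have mX : measurable_fun (setT : set (g_sigma_algebraType G)) (X k).
  by move=> _ B mB; rewrite setTI; exact: GX.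
have mz : measurable_fun (setT : set (g_sigma_algebraType G)) (zeta k).
  by move=> _ B mB; rewrite setTI; exact: Gz.
have /(_ measurableT [set true]) :
    measurable_fun (setT : set (g_sigma_algebraType G))
      (fun w => zeta k w <= p (X k w)).
  by apply: measurable_fun_ler => //; exact: (measurableT_comp mp mX).
rewrite setTI; exact.
Qed.

Lemma filtration_X zeta n k B : (k <= n)%N -> measurable B ->
  filtration X zeta n (X k @^-1` B).
Proof.
move=> kn mB; apply: sub_sigma_algebra; exists k => //; left.
by exists B => //; rewrite setTI.
Qed.

Lemma filtration_source zeta n k B : (k <= n)%N -> measurable B ->
  filtration X zeta n (zeta k @^-1` B).
Proof.
move=> kn mB; apply: sub_sigma_algebra; exists k => //; right.
by exists B => //; rewrite setTI.
Qed.

Lemma stopping_markov_time zeta (p : E -> R) : randomization p ->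
  stopping_time X zeta (markov_time X zeta p).
Proof.
move=> [mp _] n; rewrite [X in filtration _ _ _ X](_ : _ =
    \bigcup_k (if (k <= n)%N then stops X zeta p k else set0)).
  apply: sigma_algebra_bigcup => k; case: ifPn => [kn|_];
    last exact: sigma_algebra0.
  apply: generated_stops => // B mB.
    exact: filtration_X.
  exact: filtration_source.
apply/seteqP; split=> w.
  move=> /(before_markov_timeP zeta p n.+1 w)[k kn Sk]; exists k => //.
  by rewrite -ltnS kn.
move=> [k _]; case: ifPn => // kn Sk.
by apply/(before_markov_timeP zeta p n.+1 w); exists k.
Qed.

End stopping.

Section stopped_payoff.
Context {R : realType} {dE dO : measure_display} {E : measurableType dE}
  {Omega : measurableType dO}.
Variable X : nat -> {mfun Omega >-> E}.
Variables (alpha : R) (f g h : E -> R).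
Implicit Types (V p : E -> R) (tau : Omega -> option nat).

(** The payoff of the game that is broken off at time [n], where player 1 then
    receives the discounted value of the current state. *)
Definition stopped_payoff V tau1 tau2 n (w : Omega) : R :=
  if w \in before tau1 n `|` before tau2 n then payoff alpha f g h X tau1 tau2 w
  else alpha ^+ n * V (X n w).

Lemma stopped_payoff0 V tau1 tau2 w :
  stopped_payoff V tau1 tau2 0 w = V (X 0%N w).
Proof. by rewrite /stopped_payoff !before0 setU0 in_set0 expr0 mul1r. Qed.

(** Between [n] and [n + 1] the payoff changes only if nobody has stopped
    before [n]; the four other cases are then the entries of the matrix game at
    [X n], with the next state not yet averaged out. *)
Lemma stopped_payoffS V tau1 tau2 n w :
  stopped_payoff V tau1 tau2 n.+1 w =
  if w \in before tau1 n `|` before tau2 n then stopped_payoff V tau1 tau2 n w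
  else if w \in before tau1 n.+1 then
    if w \in before tau2 n.+1 then alpha ^+ n * h (X n w)
    else alpha ^+ n * f (X n w)
  else if w \in before tau2 n.+1 then alpha ^+ n * g (X n w)
  else alpha ^+ n.+1 * V (X n.+1 w).
Proof.
rewrite /stopped_payoff; case: ifPn => [|b]; last first.
  case: ifPn => [/set_mem b'|_].
    exfalso; move: b; rewrite notin_setE; apply.
    by case: b' => /subset_before; [left|right].
  move: b; rewrite notin_setE => /not_orP[nb1 nb2].
  by rewrite !memNset.
move=> /set_mem b; case: ifPn => [->//|].
rewrite notin_setE => /not_orP[nb1 nb2]; rewrite /payoff.
case: (pselect (before tau1 n.+1 w)) => b1.
  rewrite (mem_set b1) (before_now b1 nb1).
  case: (pselect (before tau2 n.+1 w)) => b2.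
    by rewrite (mem_set b2) (before_now b2 nb2) ltnn.
  rewrite (memNset b2); case E2 : (tau2 w) => [m|//].
  by rewrite (not_before b2 E2).
rewrite (memNset b1); case: b => // b2.
rewrite (mem_set b2) (before_now b2 nb2); case E1 : (tau1 w) => [m|//].
by rewrite (not_before b1 E1) ltnNge (ltnW (not_before b1 E1)).
Qed.

Lemma stopped_payoff_le V tau1 tau2 (phi : E -> R) n w : 0 < alpha ->
  (forall x, `|f x| <= phi x) -> (forall x, `|g x| <= phi x) ->
  (forall x, `|h x| <= phi x) -> (forall x, `|V x| <= phi x) ->
  `|stopped_payoff V tau1 tau2 n w| <= \sum_(k < n.+1) alpha ^+ k * phi (X k w).
Proof.
move=> a0 fp gp hp Vp.
have phi0 x : 0 <= phi x by apply: le_trans (fp x).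
have ak k : 0 <= alpha ^+ k by rewrite exprn_ge0// ltW.
have bound u k : `|u| <= phi (X k w) ->
  `|alpha ^+ k * u| <= alpha ^+ k * phi (X k w).
  by move=> uphi; rewrite normrM (ger0_norm (ak k)) ler_wpM2l.
elim: n => [|n IH].
  by rewrite stopped_payoff0 big_ord1 expr0 mul1r.
have last_ge k : (k < n.+2)%N -> alpha ^+ k * phi (X k w) <=
    \sum_(k < n.+2) alpha ^+ k * phi (X k w).
  move=> kn; rewrite (bigD1 (Ordinal kn))//= lerDl sumr_ge0// => i _.
  by rewrite mulr_ge0.
rewrite stopped_payoffS; case: ifPn => _.
  apply: (le_trans IH); rewrite [leRHS]big_ord_recr/= lerDl.
  by rewrite mulr_ge0.
by case: ifPn => _; case: ifPn => _;
  apply: le_trans (bound _ _ _) (last_ge _ _).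
Qed.

Lemma stopped_payoff_cvg V tau1 tau2 w :
  alpha ^+ n * V (X n w) @[n --> \oo] --> 0 ->
  stopped_payoff V tau1 tau2 n w @[n --> \oo] --> payoff alpha f g h X tau1
    tau2 w.
Proof.
move=> V0; case: (pselect (exists n, (before tau1 n `|` before tau2 n) w)) =>
  [[n b]|nb].
  apply: cvg_near_cst; exists n => // m /= nm.
  rewrite /stopped_payoff mem_set//.
  by case: b => -[k tk kn]; [left|right]; exists k => //; exact: leq_trans nm.
have -> : payoff alpha f g h X tau1 tau2 w = 0.
  rewrite /payoff; case E1 : (tau1 w) => [m|].
    by exfalso; apply: nb; exists m.+1; left; exists m.
  case E2 : (tau2 w) => [m|//].
  by exfalso; apply: nb; exists m.+1; right; exists m.
rewrite (_ : (fun n => _) = (fun n => alpha ^+ n * V (X n w)))//.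
apply/funext => n; rewrite /stopped_payoff memNset// => b.
by apply: nb; exists n.
Qed.

Lemma measurable_stopped_payoff V tau1 tau2 n :
  measurable_fun setT f -> measurable_fun setT g -> measurable_fun setT h ->
  measurable_fun setT V ->
  (forall n, measurable (before tau1 n)) ->
    (forall n, measurable (before tau2 n)) ->
  measurable_fun setT (stopped_payoff V tau1 tau2 n).
Proof.
move=> mf mg mh mV m1 m2.
have mem (A : set Omega) : measurable A ->
  measurable_fun setT (fun w => w \in A).
  move=> mA; apply: (measurable_fun_bool true); rewrite setTI.
  by rewrite (_ : _ @^-1` _ = A)//; apply/seteqP;
    split => w /= => [/set_mem|/mem_set].
have mterm u k : measurable_fun setT u ->
  measurable_fun setT (fun w => alpha ^+ k * u (X k w)).
  by move=> mu; apply: measurable_funM => //; apply: measurableT_comp => //;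
    exact: (measurable_funP (X k)).
elim: n => [|n IH].
  rewrite (funext (stopped_payoff0 V tau1 tau2)).
  by apply: measurableT_comp => //; exact: (measurable_funP (X 0%N)).
rewrite (funext (stopped_payoffS V tau1 tau2 n)).
apply: measurable_fun_ifT => //; first by apply/mem/measurableU.
apply: measurable_fun_ifT; first exact: mem.
- by apply: measurable_fun_ifT; [exact: mem|exact: mterm|exact: mterm].
- by apply: measurable_fun_ifT; [exact: mem|exact: mterm|exact: mterm].
Qed.

End stopped_payoff.

(** * The optimality of one player *)

(** Player 1 draws from [xi] and is free to choose [tau]; player 2 draws from
    [eta] and stops with probability [p]. *)
Section one_sided_bound.
Context {R : realType} {dE dO : measure_display} {E : measurableType dE}
  {Omega : measurableType dO}.
Variables (Pi : R.-pker E ~> E) (Q : probability Omega R)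
  (X : nat -> {mfun Omega >-> E}) (xi eta : nat -> {mfun Omega >-> R}).
Hypothesis ind : independent_triple Q X xi eta.
Hypothesis iid_eta : iid_uniform01 eta Q.
Hypothesis markovX : forall n D A,
  sigma_of [set k | (k <= n)%N] (fun k => X k) D -> measurable A ->
  Q (D `&` X n.+1 @^-1` A) = (\int[Q]_(om in D) Pi (X n om) A)%E.
Variables (alpha : R) (f g h V p phi : E -> R).
Hypotheses (alpha0 : 0 < alpha) (mf : measurable_fun setT f)
  (mg : measurable_fun setT g) (mh : measurable_fun setT h)
  (mV : measurable_fun setT V) (mphi : measurable_fun setT phi).
Hypotheses (fphi : forall y, `|f y| <= phi y) (gphi : forall y, `|g y| <= phi y)
  (hphi : forall y, `|h y| <= phi y) (Vphi : forall y, `|V y| <= phi y).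
Hypothesis moments :
  (\sum_(n <oo) \int[Q]_w (alpha ^+ n * phi (X n w))%:E < +oo)%E.
Hypothesis iPi : forall y, (Pi y).-integrable setT (EFin \o phi).
Hypothesis rp : randomization p.
Hypothesis opp_stop : forall y, p y * h y + (1 - p y) * f y <= V y.
Hypothesis opp_go : forall y,
  p y * g y + (1 - p y) * discounted alpha Pi V y <= V y.
Variable tau : Omega -> option nat.
Hypothesis tau_stop : stopping_time X xi tau.

Let t2 := markov_time X eta p.
Let S := stops X eta p.
Let sp := stopped_payoff X alpha f g h V tau t2.

Let t2_stop : stopping_time X eta t2.
Proof. exact: stopping_markov_time rp. Qed.

Let mX n : measurable_fun setT (X n).
Proof. exact: (measurable_funP (X n)). Qed.

Let phi0 y : 0 <= phi y. Proof. exact: le_trans (fphi y). Qed.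

Let apos n : 0 < alpha ^+ n. Proof. by rewrite exprn_gt0. Qed.

Let aphi0 n w : (0 <= (alpha ^+ n * phi (X n w))%:E)%E.
Proof. by rewrite lee_fin mulr_ge0// ltW. Qed.

Let maphi n : measurable_fun setT (fun w => alpha ^+ n * phi (X n w)).
Proof. by apply: measurable_funM => //; exact: measurableT_comp. Qed.

Let iaphi n : Q.-integrable setT (fun w => (alpha ^+ n * phi (X n w))%:E).
Proof.
apply/integrableP; split; first exact/measurable_EFinP.
have -> : (\int[Q]_w `|(alpha ^+ n * phi (X n w))%:E| =
    \int[Q]_w (alpha ^+ n * phi (X n w))%:E)%E.
  by apply: eq_integral => w _; rewrite gee0_abs.
apply: le_lt_trans moments; apply: le_trans (nneseries_lim_ge n.+1 _);
  last first.
  by move=> k _ _; apply: integral_ge0 => w _; exact: aphi0.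
rewrite big_nat_recr//= leeDr// sume_ge0// => k _.
by apply: integral_ge0 => w _; exact: aphi0.
Qed.

Let iphi n : Q.-integrable setT (EFin \o (phi \o X n)).
Proof.
have /(integrableZl measurableT (alpha ^+ n)^-1) := iaphi n.
apply: eq_integrable => // w _ /=.
by rewrite -EFinM mulrA mulVf ?mul1r// gt_eqF.
Qed.

Let iphi_le n (u : E -> R) : measurable_fun setT u ->
  (forall y, `|u y| <= phi y) ->
  Q.-integrable setT (EFin \o (u \o X n)).
Proof.
move=> mu uphi; apply: integrable_dominated (iphi n).
  exact: measurableT_comp.
by move=> w /=; exact: uphi.
Qed.

Let iscale n m (u : E -> R) : measurable_fun setT u ->
  (forall y, `|u y| <= phi y) ->
  Q.-integrable setT (EFin \o ((fun y => alpha ^+ m * u y) \o X n)).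
Proof.
move=> mu uphi; have /(integrableZl measurableT (alpha ^+ m)) :=
  iphi_le n mu uphi.
by apply: eq_integrable.
Qed.

Let before_tau_draw n m : (m <= n.+1)%N ->
  <<s before_draw X xi eta n >> (before tau m).
Proof.
case: m => [_|m mn]; first by rewrite before0; exact: sigma_algebra0.
have [sX sxi _] := sub_before_draw X xi eta n.
have : filtration X xi m `<=` <<s before_draw X xi eta n >>.
  apply: filtration_sub => k B _ mB; apply: sub_sigma_algebra.
    by apply: sX; exact: sigma_of_preimage.
  by apply: sxi; exact: sigma_of_preimage.
by apply; exact: filtration_before.
Qed.

Let before_t2_draw n : <<s before_draw X xi eta n >> (before t2 n).
Proof.
case: n => [|n]; first by rewrite before0; exact: sigma_algebra0.
have [sX _ seta] := sub_before_draw X xi eta n.+1.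
have : filtration X eta n `<=` <<s before_draw X xi eta n.+1 >>.
  apply: filtration_sub => k B kn mB; apply: sub_sigma_algebra.
    by apply: sX; exact: sigma_of_preimage.
  by apply: seta; exact: sigma_of_preimage.
by apply; exact: filtration_before.
Qed.

Let before_now_known n : <<s up_to_now X xi eta n >> (before tau n.+1) /\
  <<s up_to_now X xi eta n >> (before t2 n.+1).
Proof.
have [sX sxi seta] := sub_rect3
  (@sigma_of_setT _ _ _ _ X [set k | (k <= n)%N])
  (@sigma_of_setT _ _ _ _ xi setT) (@sigma_of_setT _ _ _ _ eta setT).
split.
  have : filtration X xi n `<=` <<s up_to_now X xi eta n >>.
    apply: filtration_sub => k B kn mB; apply: sub_sigma_algebra.
      by apply: sX; exact: sigma_of_preimage.
    by apply: sxi; exact: sigma_of_preimage.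
  by apply; exact: filtration_before.
have : filtration X eta n `<=` <<s up_to_now X xi eta n >>.
  apply: filtration_sub => k B kn mB; apply: sub_sigma_algebra.
    by apply: sX; exact: sigma_of_preimage.
  by apply: seta; exact: sigma_of_preimage.
by apply; exact: filtration_before.
Qed.

Let m1 n : measurable (before tau n).
Proof. exact: (before_draw_measurable (before_tau_draw (leqnSn n))). Qed.

Let m2 n : measurable (before t2 n).
Proof. exact: (before_draw_measurable (@before_t2_draw n)). Qed.

Let msp n : measurable_fun setT (sp n).
Proof. exact: measurable_stopped_payoff. Qed.

Let isp n : Q.-integrable setT (EFin \o sp n).
Proof.
have : Q.-integrable setT
  (fun w => \sum_(k < n.+1) (alpha ^+ k * phi (X k w))%:E)%E.
  by apply: (integrable_sum measurableT) => k _; exact: iaphi.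
apply: le_integrable => //; first exact/measurable_EFinP.
move=> w _; rewrite sumEFin /= lee_fin.
by apply: le_trans (ler_norm _); exact: stopped_payoff_le.
Qed.

(* Among the paths on which the game is alive at time n, those where player 1
   stops at n and those where player 1 goes on. *)
Let A1 n := before tau n.+1 `\` (before tau n `|` before t2 n).
Let A2 n := ~` (before tau n.+1 `|` before t2 n).

Let A1_draw n : <<s before_draw X xi eta n >> (A1 n).
Proof.
apply: (@measurableD _ (g_sigma_algebraType (before_draw X xi eta n))).
  exact: before_tau_draw.
apply: (@measurableU _ (g_sigma_algebraType (before_draw X xi eta n))).
  exact: before_tau_draw.
exact: before_t2_draw.
Qed.

Let A2_draw n : <<s before_draw X xi eta n >> (A2 n).
Proof.
apply: (@measurableC _ (g_sigma_algebraType (before_draw X xi eta n))).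
apply: (@measurableU _ (g_sigma_algebraType (before_draw X xi eta n))).
  exact: before_tau_draw.
exact: before_t2_draw.
Qed.

Let A2S_now n : <<s up_to_now X xi eta n >> (A2 n `\` S n).
Proof.
have [b1 b2] := before_now_known n.
have -> : A2 n `\` S n = ~` (before tau n.+1 `|` before t2 n.+1).
  apply/seteqP; split=> w.
    move=> [/not_orP[nb1 nb2] nS] [//|b].
    by apply: nS; apply/(before_markov_timeS nb2).
  move=> /not_orP[nb1 nb2];
    have nb2' : ~ before t2 n w by move=> /subset_before.
  split; first by case.
  by move=> /(before_markov_timeS nb2').
apply: (@measurableC _ (g_sigma_algebraType (up_to_now X xi eta n))).
exact: (@measurableU _ (g_sigma_algebraType (up_to_now X xi eta n))).
Qed.

(* Whether player 2 stops at n splits every event in two. *)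
Let restrict_draw n (B : set Omega) (u : Omega -> R) :
  measurable B -> Q.-integrable setT (EFin \o u) ->
  \int[Q]_(w in B) u w = \int[Q]_(w in B `&` S n) u w
    + \int[Q]_(w in B `\` S n) u w.
Proof.
move=> mB iu; have [mp _] := rp; have mS := measurable_stops X eta n mp.
rewrite -[in LHS](setUIDK B (S n)) Rintegral_setU//.
- exact: measurableI.
- exact: measurableD.
- by rewrite setUIDK; exact: integrableS iu.
- by apply/disj_setPRL => w [_ nS] [].
Qed.

(* Against stopping at n, the mixture of player 2 concedes at most V. *)
Let step_stop n :
  \int[Q]_(w in A1 n) sp n.+1 w <= \int[Q]_(w in A1 n) sp n w.
Proof.
have GA := @A1_draw n; have mA := before_draw_measurable GA.
rewrite (restrict_draw n mA (isp n.+1)).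
have -> : \int[Q]_(w in A1 n `&` S n) sp n.+1 w =
    \int[Q]_(w in A1 n `&` S n) (alpha ^+ n * h (X n w)).
  apply: eq_Rintegral => w /set_mem[[b1 /not_orP[nb1 nb2]] Sw].
  rewrite /sp stopped_payoffS memNset; last by case.
  by rewrite mem_set// mem_set//; apply/(before_markov_timeS nb2).
have -> : \int[Q]_(w in A1 n `\` S n) sp n.+1 w =
    \int[Q]_(w in A1 n `\` S n) (alpha ^+ n * f (X n w)).
  apply: eq_Rintegral => w /set_mem[[b1 /not_orP[nb1 nb2]] Sw].
  rewrite /sp stopped_payoffS memNset; last by case.
  by rewrite mem_set// memNset// => /(before_markov_timeS nb2).
have ih := iscale n n mh hphi; have i_f := iscale n n mf fphi.
have mah : measurable_fun setT (fun y => alpha ^+ n * h y)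
  by exact: measurable_funM.
have maf : measurable_fun setT (fun y => alpha ^+ n * f y)
  by exact: measurable_funM.
rewrite (Rintegral_draw_mix ind iid_eta rp GA mah ih maf i_f).
apply: le_Rintegral => //.
- exact: (integrable_draw_mix rp mA mah ih maf i_f).
- exact: integrableS (isp n).
move=> w [b1 /not_orP[nb1 nb2]].
rewrite /sp /stopped_payoff memNset; last by case.
have := ler_wpM2l (ltW (apos n)) (opp_stop (X n w)); lra.
Qed.

(* Against going on at n, it concedes at most V as well, once the next state is
   averaged out by the Markov property. *)
Let step_go n :
  \int[Q]_(w in A2 n) sp n.+1 w <= \int[Q]_(w in A2 n) sp n w.
Proof.
have GA := @A2_draw n; have mA := before_draw_measurable GA.
rewrite (restrict_draw n mA (isp n.+1)).
have -> : \int[Q]_(w in A2 n `&` S n) sp n.+1 w =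
    \int[Q]_(w in A2 n `&` S n) (alpha ^+ n * g (X n w)).
  apply: eq_Rintegral => w /set_mem[/not_orP[nb1 nb2] Sw].
  rewrite /sp stopped_payoffS memNset; last by case=> // /subset_before.
  by rewrite memNset// mem_set//; apply/(before_markov_timeS nb2).
have -> : \int[Q]_(w in A2 n `\` S n) sp n.+1 w =
    \int[Q]_(w in A2 n `\` S n) (alpha ^+ n.+1 * V (X n.+1 w)).
  apply: eq_Rintegral => w /set_mem[/not_orP[nb1 nb2] Sw].
  rewrite /sp stopped_payoffS memNset; last by case=> // /subset_before.
  by rewrite memNset// memNset// => /(before_markov_timeS nb2).
have maV : measurable_fun setT (fun y => alpha ^+ n.+1 * V y)
  by exact: measurable_funM.
have iV y : (Pi y).-integrable setT (EFin \o V).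
  exact: integrable_dominated (iPi y).
have iaV y : (Pi y).-integrable setT (EFin \o (fun z => alpha ^+ n.+1 * V z)).
  by have /(integrableZl measurableT (alpha ^+ n.+1)) := iV y;
    exact: eq_integrable.
have [iK ->] := Rintegral_transition ind markovX (@A2S_now n) maV
  (iscale n.+1 n.+1 mV Vphi) iaV.
have mag : measurable_fun setT (fun y => alpha ^+ n * g y)
  by exact: measurable_funM.
have mK := measurable_Rintegral_kernel Pi maV.
rewrite (Rintegral_draw_mix ind iid_eta rp GA mag (iscale n n mg gphi) mK iK).
apply: le_Rintegral => //.
- exact: (integrable_draw_mix rp mA mag (iscale n n mg gphi) mK iK).
- exact: integrableS (isp n).
move=> w /not_orP[nb1 nb2].
rewrite /sp /stopped_payoff memNset; last by case=> // /subset_before.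
rewrite RintegralZl//.
have := ler_wpM2l (ltW (apos n)) (opp_go (X n w)).
rewrite /discounted exprS; lra.
Qed.

Let step n : \int[Q]_w sp n.+1 w <= \int[Q]_w sp n w.
Proof.
have GA1 := @A1_draw n; have mA1 := before_draw_measurable GA1.
have GA2 := @A2_draw n; have mA2 := before_draw_measurable GA2.
pose N := before tau n `|` before t2 n.
have mN : measurable N by exact: measurableU.
have cover : setT = N `|` (A1 n `|` A2 n).
  apply/esym; rewrite -subTset => w _.
  case: (pselect (N w)) => [|nN]; [by left|right].
  case: (pselect (before tau n.+1 w)) => b; [by left|right].
  by case=> // b2; apply: nN; right.
have split3 u : Q.-integrable setT (EFin \o u) -> \int[Q]_w u w =
    \int[Q]_(w in N) u w + (\int[Q]_(w in A1 n) u w + \int[Q]_(w in A2 n) u w).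
  move=> iu; rewrite {1}cover Rintegral_setU//; last 3 first.
  - exact: measurableU.
  - by rewrite -cover.
  - apply/disj_setPRL => w [[]//|nA2] Nw; apply: nA2.
    by case: Nw => [/subset_before|]; [left|right].
  rewrite Rintegral_setU//.
  - by apply: integrableS iu => //; exact: measurableU.
  - by apply/disj_setPRL => w nb [b _]; apply: nb; left.
rewrite !split3//; apply: lerD; last exact: lerD.
rewrite le_eqVlt; apply/orP; left; apply/eqP; apply: eq_Rintegral => w Nw.
by rewrite /sp stopped_payoffS Nw.
Qed.

Let payoff_measurable : measurable_fun setT (payoff alpha f g h X tau t2).
Proof.
(* With the value 0 after truncation, the convergence holds on all paths. *)
apply: (@measurable_fun_cvg _ _ R setT
  (fun n => stopped_payoff X alpha f g h (cst 0) tau t2 n)).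
  by move=> n; exact: measurable_stopped_payoff.
move=> w _; apply: stopped_payoff_cvg.
by under eq_fun do rewrite mulr0; exact: cvg_cst.
Qed.

(** Integrability is part of the conclusion because the bound for player 1 is
    obtained by negating the payoff under the integral. *)
Lemma expected_payoff_le x :
  (forall A, measurable A -> Q (X 0%N @^-1` A) = \d_x A) ->
  Q.-integrable setT (EFin \o payoff alpha f g h X tau t2) /\
  (\int[Q]_w (payoff alpha f g h X tau t2 w)%:E <= (V x)%:E)%E.
Proof.
move=> law0.
pose D w := (\sum_(n <oo) (alpha ^+ n * phi (X n w))%:E)%E.
have mD : measurable_fun setT D.
  by apply: ge0_emeasurable_sum => [n w _ _|n _];
    [exact: aphi0|exact/measurable_EFinP].
have D0 w : (0 <= D w)%E by exact: nneseries_ge0.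
have iD : Q.-integrable setT D.
  apply/integrableP; split=> //.
  have -> : (\int[Q]_w `|D w| = \int[Q]_w D w)%E.
    by apply: eq_integral => w _; rewrite gee0_abs.
  by rewrite integral_nneseries//; move=> n; exact/measurable_EFinP.
(* Where the dominating series converges, its terms tend to 0. *)
have cvg_ae : {ae Q, forall w, setT w ->
    (EFin \o sp n) w @[n --> \oo] --> (EFin \o payoff alpha f g h X tau t2) w}.
  have := integrable_ae measurableT iD; apply: filterS => w /(_ I) Dfin _.
  apply: cvg_EFin; first exact: nearW.
  apply: stopped_payoff_cvg.
  have : alpha ^+ n * phi (X n w) @[n --> \oo] --> 0.
    apply: cvg_series_cvg_0; apply: nnseries_is_cvg => [n|].
      by rewrite -lee_fin; exact: aphi0.
    by rewrite -ge0_fin_numE// D0.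
  move=> phi_cvg; apply: (squeeze_cvgr _ _ phi_cvg); last first.
    by rewrite -oppr0; exact: cvgN phi_cvg.
  apply: nearW => n; have := ler_wpM2l (ltW (apos n)) (Vphi (X n w)).
  rewrite -{1}(ger0_norm (ltW (apos n))) -normrM ler_norml; exact.
have dom : {ae Q, forall w n, setT w -> (`|(EFin \o sp n) w| <= D w)%E}.
  apply: aeW => w n _; apply: le_trans (nneseries_lim_ge n.+1 _) => [|k _ _];
    last exact: aphi0.
  by rewrite big_mkord sumEFin /= lee_fin; exact: stopped_payoff_le.
have [ipay _ cvgE] := @dominated_convergence _ _ R Q setT measurableT
  (fun n => EFin \o sp n) (EFin \o payoff alpha f g h X tau t2) D
  (fun n => (measurable_EFinP _ _).2 (msp n))
  ((measurable_EFinP _ _).2 payoff_measurable) cvg_ae iD dom.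
have decr n : (\int[Q]_w (sp n w)%:E <= (V x)%:E)%E.
  rewrite -[leLHS]fineK ?lee_fin;
    last exact: (integrable_fin_num measurableT (isp n)).
  elim: n => [|n IH]; last exact: le_trans (step n) IH.
  rewrite [leLHS](_ : _ = V x)//.
  rewrite (_ : sp 0%N = V \o X 0%N); last by apply/funext => w;
    exact: stopped_payoff0.
  have mV' : measurable_fun setT (EFin \o V) by exact/measurable_EFinP.
  have := @integral_pushforward _ _ _ _ R _ (mX 0%N) Q setT _ mV'
    (iphi_le 0%N mV Vphi) measurableT.
  rewrite preimage_setT /Rintegral => <-.
  rewrite (eq_measure_integral \d_x) => [|A mA _]; last exact: law0.
  by rewrite integral_dirac// diracT mul1e.
have cvgE' : (fun n => \int[Q]_w (sp n w)%:E)%E @ \oo -->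
  (\int[Q]_w (payoff alpha f g h X tau t2 w)%:E)%E := cvgE.
split=> //; rewrite -(cvg_lim _ cvgE')//; apply: lime_le;
  first by apply/cvg_ex; eexists; exact: cvgE'.
exact: nearW.
Qed.

End one_sided_bound.

(** * Measurability of the value and of the optimal mixtures *)

Lemma measurable_inv (R : realType) : measurable_fun setT (@GRing.inv R).
Proof.
rewrite -(setUv [set 0 : R]); apply/measurable_funU => //.
  exact: measurableC.
split; first exact: measurable_fun_set1.
apply: open_continuous_measurable_fun.
  by apply: closed_openC;
    exact: accessible_closed_set1 (hausdorff_accessible (@Rhausdorff R)) _.
by apply/in_setP => x /= /eqP x0; exact: inv_continuous.
Qed.

Section measurable_selection.
Context {R : realType} {d : measure_display} {T : measurableType d}.
Variables f g h w : T -> R.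
Hypotheses (mf : measurable_fun setT f) (mg : measurable_fun setT g)
  (mh : measurable_fun setT h) (mw : measurable_fun setT w).

Ltac measurable_cases := repeat first
  [ exact: mf | exact: mg | exact: mh | exact: mw
  | apply: measurable_fun_ifT | apply: measurable_and | apply: measurable_or
  | apply: measurable_fun_ler | apply: measurable_fun_ltr
  | apply: measurable_minr | apply: measurable_maxr
  | apply: measurable_fun_pair
  | apply: measurable_funM | apply: measurable_funB | apply: measurable_funD
  | exact: measurable_cst
  | apply: (measurableT_comp (@measurable_inv R)) ].

Lemma measurable_W : measurable_fun setT (fun x => W (f x) (g x) (h x) (w x)).
Proof. by rewrite /W /med; measurable_cases. Qed.

Lemma measurable_optimal_stop :
  measurable_fun setT (fun x => optimal_stop (f x) (g x) (h x) (w x)).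
Proof. by rewrite /optimal_stop; measurable_cases. Qed.

End measurable_selection.

(** * Discounted moments and the starting point *)

Section moments.
Context {R : realType} {dE dO : measure_display} {E : measurableType dE}
  {Omega : measurableType dO}.
Variables (Q : probability Omega R) (X : nat -> {mfun Omega >-> E})
  (xi1 xi2 : nat -> {mfun Omega >-> R}) (T : {mfun Omega >-> nat}) (alpha : R).
Hypothesis alpha01 : 0 < alpha < 1.

Definition finite_discounted_moment (u : E -> R) : Prop :=
  (\sum_(n <oo) \int[Q]_w (alpha ^+ n * `|u (X n w)|)%:E < +oo)%E.

Hypothesis lawT : killing_time alpha T Q.
Hypothesis indep : independent_sources X xi1 xi2 T Q.

Let alpha0 n : 0 <= alpha ^+ n.
Proof. by case/andP: alpha01 => a0 _; rewrite exprn_ge0// ltW. Qed.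

Let mX n : measurable_fun setT (X n).
Proof. exact: (measurable_funP (X n)). Qed.

Let mT n : measurable (T @^-1` [set n]).
Proof. by rewrite -[_ @^-1` _]setTI; exact: (measurable_funP T). Qed.

(** On the event [T = n] the supremum is at least |u(X_n)|, and this event has
    probability (1 - alpha) alpha^n and is independent of X_n; summing over [n]
    bounds (1 - alpha) times the discounted moments by the expected supremum.
    *)
Lemma killed_sup_finite_moment (u : E -> R) : measurable_fun setT u ->
  killed_sup_integrable X T u Q -> finite_discounted_moment u.
Proof.
move=> mu isup; have [_ alpha1] := andP alpha01;
  rewrite /finite_discounted_moment.
pose M w := ereal_sup (range (fun n => `|oapp u 0 (killed X T n w)|%:E)).
have [mM finM] : measurable_fun setT M /\ (\int[Q]_w `|M w| < +oo)%E.
  by have /integrableP := isup.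
have M_ge n w : T w = n -> (`|u (X n w)|%:E <= M w)%E.
  by move=> Tn; apply: ereal_sup_ubound; exists n => //;
    rewrite /killed Tn leqnn.
have M0 w : (0 <= M w)%E by apply: le_trans (M_ge (T w) w erefl);
  rewrite lee_fin.
have mu_abs n : measurable_fun setT (fun w => `|u (X n w)|%:E).
  apply/measurable_EFinP; apply: measurableT_comp => //.
  exact: measurableT_comp.
have c0 n : 0 <= (1 - alpha) * alpha ^+ n by rewrite mulr_ge0// subr_ge0 ltW.
have scaled n : (\int[Q]_(w in T @^-1` [set n]) `|u (X n w)|%:E =
    ((1 - alpha) * alpha ^+ n)%:E * \int[Q]_w `|u (X n w)|%:E)%E.
  apply: (@ge0_integral_scaled_law _ _ _ Q _ _ _ _ (mT n) measurableT
    (NngNum (c0 n)) (X n) (fun y => `|u y|%:E)) => //.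
    move=> B mB; rewrite setTI /= -lawT.
    by apply: (independent_sources_time _ indep); exact: sigma_of_preimage.
  by apply/measurable_EFinP; exact: measurableT_comp.
have cover : \bigcup_n (T @^-1` [set n]) = setT.
  by rewrite -subTset => w _; exists (T w).
have sumM : (\sum_(n <oo) \int[Q]_(w in T @^-1` [set n]) M w < +oo)%E.
  rewrite -ge0_integral_bigcup//; last 2 first.
  - by rewrite cover.
  - by move=> i j _ _ [w [<- <-]].
  rewrite cover; apply: le_lt_trans finM.
  by rewrite le_eqVlt; apply/orP; left; apply/eqP/eq_integral => w _;
    rewrite gee0_abs.
have : (\sum_(n <oo)
  ((1 - alpha)%:E * \int[Q]_w (alpha ^+ n * `|u (X n w)|)%:E) < +oo)%E.
  apply: le_lt_trans sumM; apply: lee_nneseries => [n _ _|n _].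
    rewrite mule_ge0 ?lee_fin; [by []|lra|].
    by apply: integral_ge0 => w _; rewrite lee_fin mulr_ge0.
  rewrite [leLHS](_ : _ = \int[Q]_(w in T @^-1` [set n]) `|u (X n w)|%:E)%E.
    apply: ge0_le_integral => //.
    - exact: measurable_funTS.
    - exact: measurable_funTS.
    - by move=> w Tn; exact: M_ge.
  rewrite scaled EFinM -muleA; congr (_ * _)%E.
  under eq_integral do rewrite EFinM.
  by rewrite ge0_integralZl// lee_fin.
rewrite nneseriesZl; last first.
  by move=> n _; apply: integral_ge0 => w _; rewrite lee_fin mulr_ge0.
have a1 : (0 < (1 - alpha)%:E)%E by rewrite lte_fin; lra.
rewrite [X in (X < _)%E -> _]muleC => fin; rewrite ltNge leye_eq;
  apply/negP => /eqP sumE.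
by move: fin; rewrite sumE gt0_mulye// ltxx.
Qed.

Lemma finite_discounted_momentD3 (f g h : E -> R) : measurable_fun setT f ->
  measurable_fun setT g -> measurable_fun setT h ->
  finite_discounted_moment f -> finite_discounted_moment g ->
  finite_discounted_moment h ->
  (\sum_(n <oo) \int[Q]_w
    (alpha ^+ n * (`|f (X n w)| + `|g (X n w)| + `|h (X n w)|))%:E < +oo)%E.
Proof.
move=> mf mg mh ff fg fh.
have m_abs (u : E -> R) n : measurable_fun setT u ->
    measurable_fun setT (fun w => (alpha ^+ n * `|u (X n w)|)%:E).
  move=> mu; apply/measurable_EFinP; apply: measurable_funM => //.
  by apply: measurableT_comp => //; exact: measurableT_comp.
have abs0 (u : E -> R) n w : (0 <= (alpha ^+ n * `|u (X n w)|)%:E)%E.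
  by rewrite lee_fin mulr_ge0.
have int0 (u : E -> R) n : (0 <= \int[Q]_w (alpha ^+ n * `|u (X n w)|)%:E)%E.
  by apply: integral_ge0 => w _.
rewrite (eq_eseriesr (g := fun n => (\int[Q]_w (alpha ^+ n * `|f (X n w)|)%:E +
    \int[Q]_w (alpha ^+ n * `|g (X n w)|)%:E +
    \int[Q]_w (alpha ^+ n * `|h (X n w)|)%:E)%E)) => [|n _].
  rewrite nneseriesD// => [|n _ _]; last exact: adde_ge0.
  by rewrite nneseriesD// !lte_add_pinfty.
rewrite -ge0_integralD//; [|exact: m_abs|exact: m_abs].
rewrite -ge0_integralD//.
- by apply: eq_integral => w _; rewrite -!EFinD !mulrDr.
- by move=> w _; exact: adde_ge0.
- by apply: emeasurable_funD; exact: m_abs.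
- exact: m_abs.
Qed.

End moments.

Section dirac_start.
Context {R : realType} {dE dO : measure_display} {E : measurableType dE}
  {Omega : measurableType dO}.
Variables (Q : probability Omega R)
  (X : nat -> {mfun Omega >-> E}) (x : E).
Hypothesis law0 : forall A, measurable A -> Q (X 0%N @^-1` A) = \d_x A.

Lemma ge0_integral_start (F : E -> \bar R) : measurable_fun setT F ->
  (forall y, 0 <= F y)%E -> (\int[Q]_w F (X 0%N w) = F x)%E.
Proof.
move=> mF F0; have mX0 :
  measurable_fun setT (X 0%N) by exact: (measurable_funP (X 0%N)).
transitivity (\int[pushforward Q (X 0%N)]_y F y)%E.
  by rewrite (ge0_integral_pushforward mX0).
rewrite (eq_measure_integral \d_x) => [|A mA _]; last exact: law0.
by rewrite integral_dirac// diracT mul1e.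
Qed.

End dirac_start.

(** * Existence of a value function *)

Lemma W_lipschitz (R : realType) (f g h w w' : R) :
  `|W f g h w - W f g h w'| <= `|w - w'|.
Proof. exact: matrix_saddle_lipschitz (matrix_saddle_W _ _ _ _)
  (matrix_saddle_W _ _ _ _). Qed.

Lemma W_le (R : realType) (f g h w w' : R) : w <= w' -> W f g h w <= W f g h w'.
Proof. exact: matrix_saddle_le (matrix_saddle_W _ _ _ _)
  (matrix_saddle_W _ _ _ _). Qed.

Lemma W_bound (R : realType) (f g h w : R) : `|W f g h w| <= `|f| + `|g| + `|h|.
Proof. exact: matrix_saddle_bound (matrix_saddle_W _ _ _ _). Qed.

Section value_iteration.
Context {R : realType} {dE : measure_display} {E : measurableType dE}.
Variables (Pi : R.-pker E ~> E) (alpha : R) (f g h : E -> R).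
Hypotheses (alpha0 : 0 < alpha) (mf : measurable_fun setT f)
  (mg : measurable_fun setT g) (mh : measurable_fun setT h).
Let phi y := `|f y| + `|g y| + `|h y|.
Hypothesis iPi : forall y, (Pi y).-integrable setT (EFin \o phi).

(** The starting point [- phi] lies below every value of [W], which makes the
    iteration nondecreasing. *)
Fixpoint value_iterate n : E -> R :=
  if n is m.+1 then
    fun x => W (f x) (g x) (h x) (discounted alpha Pi (value_iterate m) x)
  else fun x => - phi x.

Let V := value_iterate.

Let mphi : measurable_fun setT phi.
Proof.
by apply: measurable_funD; [apply: measurable_funD|]; exact: measurableT_comp.
Qed.

Let phi0 y : 0 <= phi y. Proof. by rewrite !addr_ge0. Qed.

Let mdisc u : measurable_fun setT u ->
  measurable_fun setT (discounted alpha Pi u).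
Proof.
by move=> mu; apply: measurable_funM => //; exact: measurable_Rintegral_kernel.
Qed.

Let mVn n : measurable_fun setT (V n).
Proof.
elim: n => [|n IH]; first exact: measurable_funN.
by apply: measurable_W => //; exact: mdisc.
Qed.

Let Vphi n y : `|V n y| <= phi y.
Proof. by case: n => [|n]; [rewrite normrN ger0_norm|exact: W_bound]. Qed.

Let iVn n y : (Pi y).-integrable setT (EFin \o V n).
Proof.
exact: integrable_dominated (iPi y).
Qed.

Let V_incr n y : V n y <= V n.+1 y.
Proof.
elim: n y => [|n IH] y.
  by have := Vphi 1 y; rewrite ler_norml => /andP[].
apply: W_le; rewrite /discounted ler_pM2l//.
by apply: le_Rintegral => //; exact: (iVn n.+1).
Qed.

(** The iterates increase and stay below [phi], hence converge; dominated
    convergence passes to the limit in the integral and the Lipschitz bound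
    passes to the limit in [W]. *)
Lemma exists_measurable_fixpoint : exists2 U : E -> R, measurable_fun setT U &
  forall x, U x = W (f x) (g x) (h x) (discounted alpha Pi U x).
Proof.
pose U y := limn (V ^~ y).
have VU y : V ^~ y @ \oo --> U y.
  apply: nondecreasing_is_cvgn.
    by apply/nondecreasing_seqP => n; exact: V_incr.
  by exists (phi y) => _ [n _ <-]; exact: le_trans (ler_norm _) (Vphi n y).
have mU : measurable_fun setT U.
  by apply: (@measurable_fun_cvg _ _ R setT V) => // y _; exact: VU.
exists U => // x.
have VU_ae : {ae Pi x, forall y, setT y ->
  (EFin \o V n) y @[n --> \oo] --> (EFin \o U) y}.
  by apply: aeW => y _; apply: cvg_EFin; [exact: nearW|exact: VU].
have V_dom : {ae Pi x, forall y n, setT y ->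
  (`|(EFin \o V n) y| <= (EFin \o phi) y)%E}.
  by apply: aeW => y n _; rewrite /= lee_fin.
have [iU _ intVU] := @dominated_convergence _ _ R (Pi x) setT measurableT
  (fun n => EFin \o V n) (EFin \o U) (EFin \o phi)
  (fun n => (measurable_EFinP _ _).2 (mVn n)) ((measurable_EFinP _ _).2 mU)
  VU_ae (iPi x) V_dom.
have RintVU : \int[Pi x]_y V n y @[n --> \oo] --> \int[Pi x]_y U y.
  apply: fine_cvg; rewrite fineK;
    last exact: (integrable_fin_num measurableT iU).
  exact: intVU.
have discVU : discounted alpha Pi (V n) x @[n --> \oo] --> discounted alpha Pi
  U x.
  exact: cvgMr.
have VSU : V n.+1 x @[n --> \oo] --> W (f x) (g x) (h x)
  (discounted alpha Pi U x).
  apply/cvgrPdist_le => e e0; move/cvgrPdist_le : discVU => /(_ e e0).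
  by apply: filterS => n; exact: le_trans (W_lipschitz _ _ _ _ _).
apply: (cvg_unique _ _ VSU) => //.
by have := VU x; rewrite -(cvg_shiftS (V ^~ x)).
Qed.

End value_iteration.

(** * Equilibria *)

(** Exchanging the players and the signs turns the minimizer into a maximizer.
    *)
Lemma payoff_swap (R : realType) (dE dO : measure_display)
    (E : measurableType dE) (Omega : measurableType dO) (alpha : R)
    (f g h : E -> R) (X : nat -> {mfun Omega >-> E})
    (tau1 tau2 : Omega -> option nat) w :
  payoff alpha (\- g) (\- f) (\- h) X tau2 tau1 w
    = - payoff alpha f g h X tau1 tau2 w.
Proof.
rewrite /payoff; case: (tau1 w) => [m|]; case: (tau2 w) => [n|];
  rewrite /= ?mulrN ?oppr0//.
by case: ltngtP => [||->]; rewrite ?mulrN.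
Qed.

Section equilibrium.
Context (R : realType) (dE dO : measure_display)
  (E : measurableType dE) (Omega : measurableType dO)
  (Pi : R.-pker E ~> E) (P : E -> probability Omega R)
  (X : nat -> {mfun Omega >-> E}) (xi1 xi2 : nat -> {mfun Omega >-> R})
  (T : {mfun Omega >-> nat}) (alpha : R) (f g h : E -> R)
  (alpha01 : 0 < alpha < 1)
  (mf : measurable_fun setT f) (mg : measurable_fun setT g)
  (mh : measurable_fun setT h)
  (markovX : forall x, markov_process Pi X x (P x))
  (iid1 : forall x, iid_uniform01 xi1 (P x))
  (iid2 : forall x, iid_uniform01 xi2 (P x))
  (lawT : forall x, killing_time alpha T (P x))
  (indep : forall x, independent_sources X xi1 xi2 T (P x))
  (intf : forall x, killed_sup_integrable X T f (P x))
  (intg : forall x, killed_sup_integrable X T g (P x))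
  (inth : forall x, killed_sup_integrable X T h (P x)).

Let phi y := `|f y| + `|g y| + `|h y|.

Let mphi : measurable_fun setT phi.
Proof.
by apply: measurable_funD; [apply: measurable_funD|]; exact: measurableT_comp.
Qed.

Let alpha0 : 0 < alpha. Proof. by case/andP: alpha01. Qed.

Let ind x : independent_triple (P x) X xi1 xi2.
Proof. exact: independent_sources_triple (indep x). Qed.

Let moments x : (\sum_(n <oo) \int[P x]_w (alpha ^+ n * phi (X n w))%:E <
  +oo)%E.
Proof.
by apply: finite_discounted_momentD3 => //;
  exact: (killed_sup_finite_moment alpha01 (lawT x) (indep x)).
Qed.

(** Under [P y], the law of X_1 is [Pi y], so the term with index 1 of the
    discounted moments is the integral of alpha phi against [Pi y]. *)
Lemma kernel_integrable y : (Pi y).-integrable setT (EFin \o phi).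
Proof.
have [law0 trans] := markovX y.
have aphi0 n z : (0 <= (alpha ^+ n * phi z)%:E)%E.
  by rewrite lee_fin mulr_ge0 ?exprn_ge0 ?(ltW alpha0)// !addr_ge0.
pose F z := (alpha * phi z)%:E.
have F0 z : (0 <= F z)%E by exact: (aphi0 1%N).
have mF : measurable_fun setT F by apply/measurable_EFinP;
  exact: measurable_funM.
have mPiF : measurable_fun setT (fun z => \int[Pi z]_y F y)%E.
  by apply: measurable_fun_integral_kernel => // U mU; exact: measurable_kernel.
have finF : (\int[Pi y]_z F z < +oo)%E.
  rewrite -(ge0_integral_start law0 mPiF); last by move=> z;
    exact: integral_ge0.
  rewrite -(ge0_integral_transition (ind y) trans _ mF)//; last first.
    exact: (@measurableT _ (g_sigma_algebraType (up_to_now X xi1 xi2 0))).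
  apply: le_lt_trans (moments y); apply: le_trans (nneseries_lim_ge 2 _);
    last first.
    by move=> k _ _; apply: integral_ge0.
  rewrite big_nat_recr//= leeDr// sume_ge0// => k _; exact: integral_ge0.
have iF : (Pi y).-integrable setT F.
  apply/integrableP; split=> //.
  by rewrite (eq_integral F)// => z _; rewrite gee0_abs.
have := integrableZl measurableT alpha^-1 iF; apply: eq_integrable => // z _.
by rewrite /F /= -EFinM mulrA mulVf ?mul1r// gt_eqF.
Qed.

(** Saddle points of the matrix games in all states make up an equilibrium:
    each player secures V against every stopping time of the other one, so V is
    the payoff when both use their saddle point, and neither can improve on it.
    *)
Lemma matrix_saddle_equilibrium (V p1 p2 : E -> R) :
  measurable_fun setT V -> randomization p1 -> randomization p2 ->
  (forall x, matrix_saddle (f x) (g x) (h x) (discounted alpha Pi V x) (V x)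
    (p1 x) (p2 x)) ->
  global_markov_equilibrium alpha f g h X xi1 xi2 P p1 p2 /\
  (forall x, J1 alpha f g h X (P x)
    (markov_time X xi1 p1) (markov_time X xi2 p2) = (V x)%:E).
Proof.
move=> mV rp1 rp2 saddle.
set t1 := markov_time X xi1 p1; set t2 := markov_time X xi2 p2.
have Vphi y : `|V y| <= phi y by exact: matrix_saddle_bound (saddle y).
have fphi y : `|f y| <= phi y by rewrite /phi -addrA lerDl addr_ge0.
have gphi y : `|g y| <= phi y by rewrite /phi addrAC lerDr addr_ge0.
have hphi y : `|h y| <= phi y by rewrite /phi lerDr addr_ge0.
have iV y : (Pi y).-integrable setT (EFin \o V).
  exact: integrable_dominated (kernel_integrable y).
have upper x tau : stopping_time X xi1 tau ->
    (J1 alpha f g h X (P x) tau t2 <= (V x)%:E)%E.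
  move=> tau_stop; have [law0 trans] := markovX x; rewrite /J1 unlock.
  apply: (expected_payoff_le (ind x) (iid2 x) trans alpha0 mf mg mh mV mphi
    fphi gphi hphi Vphi (moments x) kernel_integrable rp2 _ _ tau_stop law0).2
      => y.
    by have [_ _ _ []] := saddle y.
  by have [_ _ _ []] := saddle y.
have lower x tau : stopping_time X xi2 tau ->
    ((V x)%:E <= J1 alpha f g h X (P x) t1 tau)%E.
  move=> tau_stop; have [law0 trans] := markovX x; rewrite /J1 unlock.
  have discN y : discounted alpha Pi (\- V) y = - discounted alpha Pi V y.
    rewrite /discounted -mulrN; congr (_ * _); rewrite -mulN1r -RintegralZl//.
    by apply: eq_Rintegral => z _; rewrite mulN1r.
  have normN (u : E -> R) : (forall y, `|u y| <= phi y) ->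
    forall y, `|(\- u) y| <= phi y.
    by move=> uphi y; rewrite normrN.
  have opp_stop y : p1 y * (\- h) y + (1 - p1 y) * (\- g) y <= (\- V) y.
    by have [_ _ _ []] := matrix_saddle_opp (saddle y).
  have opp_go y : p1 y * (\- f) y
    + (1 - p1 y) * discounted alpha Pi (\- V) y <= (\- V) y.
    by rewrite discN; have [_ _ _ []] := matrix_saddle_opp (saddle y).
  have [iN] := expected_payoff_le (independent_tripleC (ind x)) (iid1 x) trans
    alpha0 (measurable_funN mg) (measurable_funN mf) (measurable_funN mh)
    (measurable_funN mV) mphi (normN _ gphi) (normN _ fphi) (normN _ hphi)
    (normN _ Vphi) (moments x) kernel_integrable rp1 opp_stop opp_go tau_stop
      law0.
  rewrite EFinN leeNr -integralN; last exact: integrable_add_def.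
  by under eq_integral do rewrite payoff_swap EFinN oppeK.
have t1_stop : stopping_time X xi1 t1 by exact: stopping_markov_time.
have t2_stop : stopping_time X xi2 t2 by exact: stopping_markov_time.
have JV x : J1 alpha f g h X (P x) t1 t2 = (V x)%:E.
  by apply/eqP; rewrite eq_le upper// lower.
split=> // J u1 u2 x; split; apply/eqP; rewrite eq_le; apply/andP; split.
- by apply: ge_ereal_sup => _ [tau tau_stop <-];
    exact: le_trans (upper x tau tau_stop) (lower x t2 t2_stop).
- by apply: ereal_sup_ubound; exists t1.
- by apply: le_ereal_inf_tmp => _ [tau tau_stop <-];
    exact: le_trans (upper x t1 t1_stop) (lower x tau tau_stop).
- by apply: ereal_inf_lbound; exists t2.
Qed.

End equilibrium.

Theorem theorem5p4 (R : realType) (dE dO : measure_display)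
  (E : measurableType dE) (Omega : measurableType dO)
  (Pi : R.-pker E ~> E) (P : E -> probability Omega R)
  (X : nat -> {mfun Omega >-> E}) (xi1 xi2 : nat -> {mfun Omega >-> R})
  (T : {mfun Omega >-> nat}) (alpha : R) (f g h : E -> R)
  (alpha01 : 0 < alpha < 1)
  (mf : measurable_fun setT f) (mg : measurable_fun setT g)
  (mh : measurable_fun setT h)
  (markovX : forall x, markov_process Pi X x (P x))
  (iid1 : forall x, iid_uniform01 xi1 (P x))
  (iid2 : forall x, iid_uniform01 xi2 (P x))
  (lawT : forall x, killing_time alpha T (P x))
  (indep : forall x, independent_sources X xi1 xi2 T (P x))
  (intf : forall x, killed_sup_integrable X T f (P x))
  (intg : forall x, killed_sup_integrable X T g (P x))
  (inth : forall x, killed_sup_integrable X T h (P x)) :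
  (forall (V p1 p2 : E -> R),
     measurable_fun setT V ->
     (forall x, V x = W (f x) (g x) (h x) (discounted alpha Pi V x)) ->
     randomization p1 -> randomization p2 ->
     saddle_choice f g h (discounted alpha Pi V) p1 p2 ->
     global_markov_equilibrium alpha f g h X xi1 xi2 P p1 p2 /\
     (forall x, J1 alpha f g h X (P x)
                  (markov_time X xi1 p1) (markov_time X xi2 p2) = (V x)%:E)) /\
  (exists p1 p2 : E -> R,
     [/\ randomization p1, randomization p2
       & global_markov_equilibrium alpha f g h X xi1 xi2 P p1 p2]).
Proof.
have equilibrium := matrix_saddle_equilibrium alpha01 mf mg mh markovX iid1 iid2
  lawT indep intf intg inth.
split=> [V p1 p2 mV VW rp1 rp2 choice|].
  apply: equilibrium => // x; rewrite VW.
  have := matrix_saddle_W (f x) (g x) (h x) (discounted alpha Pi V x).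
  by rewrite -(saddle_choice_optimal_stop choice).
have [alpha0 _] := andP alpha01.
have iPi := kernel_integrable alpha01 mf mg mh markovX lawT indep intf intg
  inth.
have [V mV VW] := exists_measurable_fixpoint alpha0 mf mg mh iPi.
have mdV : measurable_fun setT (discounted alpha Pi V).
  by apply: measurable_funM => //; exact: measurable_Rintegral_kernel.
pose s x := optimal_stop (f x) (g x) (h x) (discounted alpha Pi V x).
have saddle x : matrix_saddle (f x) (g x) (h x) (discounted alpha Pi V x) (V x)
    (s x).1 (s x).2 by rewrite VW; exact: matrix_saddle_W.
have ms : measurable_fun setT s by exact: measurable_optimal_stop.
have rp1 : randomization (fun x => (s x).1).
  split=> [|x]; last by have [] := saddle x.
  exact: (measurableT_comp measurable_fst ms).
have rp2 : randomization (fun x => (s x).2).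
  split=> [|x]; last by have [] := saddle x.
  exact: (measurableT_comp measurable_snd ms).
exists (fun x => (s x).1), (fun x => (s x).2); split=> //.
by have [] := equilibrium V _ _ mV rp1 rp2 saddle.
Qed.
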